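(* Let $\Gamma$ be a finite abelian group which acts faithfully and linearly on a finite-dimensional real vector space $V$. Then any linear Poisson structure $\pi$ on $S(V^* )\rtimes\Gamma$ is quantizable.
   Context: All vector spaces and algebras are over $\mathbb{R}$. Fix a $\Gamma$-invariant inner product on $V$. For $\gamma\in\Gamma$, let $V^\gamma$ be the fixed subspace, $N^\gamma=(V^\gamma)^\perp\subset V$, and $l(\gamma)=\dim_{\mathbb R} N^\gamma$. Thus $V=V^\gamma\oplus N^\gamma$ and $V^*=(V^\gamma)^*\oplus (N^\gamma)^*$, where $(V^\gamma)^*$ is identified with the functionals vanishing on $N^\gamma$. $A=S(V^* )\rtimes\Gamma$ is the crossed product of the polynomial algebra $S(V^* )$ with $\Gamma$, with $\gamma x={}^\gamma x\,\gamma$ for $x\in V^*$. The group $\Gamma$ acts on families $(f_\gamma)_{\gamma\in\Gamma}$, $f_\gamma\in S(V^* )\otimes\wedge^\bullet V$, by $(g\cdot f)_{g\gamma g^{-1}}=g(f_\gamma)$, and $(\cdot)^\Gamma$ denotes invariants. Let $\mathsf{pr}_\gamma: S(V^* )\otimes\wedge^n V\to S((V^\gamma)^* )\otimes\wedge^{n-l(\gamma)}V^\gamma\otimes\wedge^{l(\gamma)}N^\gamma$ be the projection determined by $V=V^\gamma\oplus N^\gamma$ (restrict polynomials to $V^\gamma$, project polyvectors). It is known that $H^n(A,A)\cong\big(\bigoplus_{\gamma\in\Gamma}S((V^\gamma)^* )\otimes\wedge^{n-l(\gamma)}V^\gamma\otimes\wedge^{l(\gamma)}N^\gamma\big)^\Gamma$.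 For $n=2$ the isomorphism is as follows. Every class is represented by an $\mathbb{R}\Gamma$-bilinear cocycle $m$ (that is, $m(\gamma a,b)=\gamma m(a,b)$, $m(a\gamma,b)=m(a,\gamma b)$, $m(a,b\gamma)=m(a,b)\gamma$); writing $m(x,y)-m(y,x)=\sum_\gamma f_\gamma(x,y)\gamma$ for $x,y\in V^*$, with $f_\gamma\in S(V^* )\otimes\wedge^2V$, the class goes to $(\mathsf{pr}_\gamma f_\gamma)_\gamma$. A linear Poisson structure on $A$ is an element $\pi=(\pi_\gamma)_\gamma$ of $(V^*\otimes\wedge^2V)^\Gamma\oplus\big(\bigoplus_{l(\gamma)=2}(V^\gamma)^*\otimes\wedge^2N^\gamma\big)^\Gamma\subset H^2(A,A)$ (each $\pi_\gamma$ viewed as an antisymmetric bilinear map $V^*\times V^*\to V^*$) whose Gerstenhaber bracket with itself vanishes, i.e. $\mathsf{pr}_\gamma\big([\![\pi,\pi]\!]_\gamma\big)=0$ for all $\gamma\in\Gamma$, where for $x,y,z\in V^*$ $$[\![\pi,\pi]\!]_\gamma(x,y,z)=\sum_{\alpha\beta=\gamma}\pi_\alpha(\pi_\beta(x,y),z+{}^\beta z)+\pi_\alpha(\pi_\beta(y,z),x+{}^\beta x)+\pi_\alpha(\pi_\beta(z,x),y+{}^\beta y).$$ A Poisson structure $\pi\in H^2(A,A)$ is quantizable if there is an associative $\mathbb{R}[[\hbar]]$-bilinear product $a\star b=ab+\sum_{k\ge1}\hbar^k m_k(a,b)$ ($a,b\in A$) on $A[[\hbar]]$ such that the Hochschild 2-cocycle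 $m_1$ has class $\pi$ in $H^2(A,A)$. *)

(* Defs.v *)
From HB Require Import structures.
From mathcomp Require Import all_boot all_order all_algebra all_fingroup.
From mathcomp Require Import mxrepresentation sesquilinear mpoly reals.

Set Implicit Arguments.
Unset Strict Implicit.
Unset Printing Implicit Defensive.

Import GRing.Theory.

Local Open Scope ring_scope.

(* The Gamma-module V is the space 'cV[R]_n of column vectors, with g acting  *)
(* by v |-> rG g *m v. Its dual V^* is the space 'rV[R]_n of row vectors,     *)
(* with pairing x *m v, so that a matrix M acting on V by M *m v induces the  *)
(* map x |-> x *m M (precomposition) on V^*. The symmetric algebra S(V^* ) is *)
(* {mpoly R[n]}, where 'X_i is the i-th coordinate function on V.             *)

Section SymmetricAlgebra.
Variables (R : fieldType) (n : nat).
Implicit Types (x y : 'rV[R]_n) (M N : 'M[R]_n) (p q : {mpoly R[n]}).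

Definition linform x : {mpoly R[n]} := \sum_(i < n) x 0 i *: 'X_i.

(* The algebra endomorphism of S(V^* ) extending x |-> x *m M.                *)
Definition sym_map M p : {mpoly R[n]} :=
  p \mPo [tuple linform (row i M) | i < n].

Lemma linform_is_linear : linear linform.
Proof.
move=> a x y; rewrite /linform scaler_sumr -big_split /=.
by apply: eq_bigr => i _; rewrite !mxE scalerDl scalerA.
Qed.

HB.instance Definition _ :=
  GRing.isLinear.Build R 'rV[R]_n {mpoly R[n]} _ linform linform_is_linear.

Lemma linform_delta i : linform (delta_mx 0 i) = 'X_i.
Proof.
rewrite /linform (bigD1 i) //= big1 ?addr0 => [|j /negPf ji].
  by rewrite mxE !eqxx scale1r.
by rewrite mxE ji andbF scale0r.
Qed.

Lemma sym_mapX M i : sym_map M 'X_i = linform (row i M).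
Proof. by rewrite /sym_map comp_mpolyXU -tnth_nth tnth_mktuple. Qed.

Lemma sym_map_linform M x : sym_map M (linform x) = linform (x *m M).
Proof.
rewrite {1}/linform /sym_map linear_sum mulmx_sum_row linear_sum /=.
by apply: eq_bigr => i _; rewrite !linearZ /= -/(sym_map M _) sym_mapX.
Qed.

Lemma sym_map_comp M N p : sym_map N (sym_map M p) = sym_map (M *m N) p.
Proof.
rewrite [sym_map M p]/sym_map [RHS]/sym_map !comp_mpolyEX /sym_map linear_sum.
apply: eq_bigr => m _; rewrite /= linearZ /= !comp_mpolyX rmorph_prod /=.
congr (_ *: _); apply: eq_bigr => i _.
by rewrite rmorphXn /= !tnth_mktuple -/(sym_map N _) sym_map_linform row_mul.
Qed.

Lemma sym_map1 p : sym_map 1%:M p = p.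
Proof.
rewrite -[RHS]comp_mpoly_id /sym_map; congr (_ \mPo _).
by apply: eq_from_tnth => i; rewrite !tnth_mktuple rowE mulmx1 linform_delta.
Qed.

End SymmetricAlgebra.

Section CrossedProduct.
Variables (R : fieldType) (gT : finGroupType) (n : nat).
Variable rG : mx_representation R [set: gT] n.
Implicit Types (g h : gT) (p q : {mpoly R[n]}).

(* The contragredient action (g x)(v) = x (g^-1 v) on V^*.                    *)
Definition dual_act g (x : 'rV[R]_n) : 'rV[R]_n := x *m rG g^-1%g.

Definition sym_act g p : {mpoly R[n]} := sym_map (rG g^-1%g) p.

(* a : crossed_product stands for \sum_g a g * g. The parameter rG     *)
(* does not occur in the type itself, but determines its multiplication.      *)
Definition crossed_product of mx_representation R [set: gT] n : Type :=
  {ffun gT -> {mpoly R[n]}}.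

HB.instance Definition _ :=
  GRing.Lmodule.copy (crossed_product rG) {ffun gT -> {mpoly R[n]}}.

Local Notation A := (crossed_product rG).
Implicit Types a b c : A.

Definition cp_elt p g : A := [ffun h => if h == g then p else 0].

Definition cp_one : A := cp_elt 1 1%g.

(* (p g) * (q h) = p (g q) (g h)                                              *)
Definition cp_mul a b : A :=
  [ffun g => \sum_h a h * sym_act h (b (h^-1 * g)%g)].

Lemma sym_act1 p : sym_act 1%g p = p.
Proof. by rewrite /sym_act invg1 repr_mx1 sym_map1. Qed.

Lemma sym_actM g h p : sym_act (g * h)%g p = sym_act g (sym_act h p).
Proof.
by rewrite /sym_act sym_map_comp invMg repr_mxM ?inE.
Qed.

Lemma cp_mulA : associative cp_mul.
Proof.
move=> a b c; apply/ffunP => g; rewrite !ffunE.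
under eq_bigr => h _.
  rewrite ffunE /sym_act /sym_map linear_sum /= mulr_sumr.
  under eq_bigr => k _.
    rewrite rmorphM /= -!/(sym_map _ _) -!/(sym_act _ _) -sym_actM.
    rewrite mulrA mulgA -invMg.
    over.
  over.
rewrite /= exchange_big /=.
under [RHS]eq_bigr => k _ do rewrite ffunE mulr_suml.
rewrite [RHS]exchange_big /= [LHS]exchange_big /=; apply: eq_bigr => h _.
rewrite [RHS](reindex_inj (mulgI h)) /=.
by apply: eq_bigr => k _; rewrite mulKg.
Qed.

Lemma cp_mul1l : left_id cp_one cp_mul.
Proof.
move=> a; apply/ffunP => g; rewrite ffunE (bigD1 1%g) //= big1 => [|h hn].
  by rewrite ffunE eqxx mul1r sym_act1 invg1 mul1g addr0.
by rewrite ffunE (negPf hn) mul0r.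
Qed.

Lemma cp_mul1r : right_id cp_one cp_mul.
Proof.
move=> a; apply/ffunP => g; rewrite ffunE (bigD1 g) //= big1 => [|h hn].
  by rewrite ffunE mulVg eqxx /sym_act /sym_map rmorph1 mulr1 addr0.
rewrite ffunE -eq_mulVg1 (negPf hn) /sym_act /sym_map rmorph0 mulr0 //.
Qed.

Lemma cp_mulDl : left_distributive cp_mul +%R.
Proof.
move=> a b c; apply/ffunP => g; rewrite !ffunE -big_split /=.
by apply: eq_bigr => h _; rewrite ffunE mulrDl.
Qed.

Lemma cp_mulDr : right_distributive cp_mul +%R.
Proof.
move=> a b c; apply/ffunP => g; rewrite !ffunE -big_split /=.
by apply: eq_bigr => h _; rewrite ffunE /sym_act /sym_map rmorphD /= mulrDr.
Qed.

Lemma cp_one_neq0 : cp_one != 0.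
Proof.
apply/eqP => /ffunP/(_ 1%g); rewrite !ffunE eqxx => /eqP.
by rewrite oner_eq0.
Qed.

HB.instance Definition _ := GRing.Zmodule_isNzRing.Build A
  cp_mulA cp_mul1l cp_mul1r cp_mulDl cp_mulDr cp_one_neq0.

Lemma cp_scaleAl (r : R) a b : r *: (a * b) = (r *: a) * b.
Proof.
apply/ffunP => g; rewrite !ffunE scaler_sumr; apply: eq_bigr => h _.
by rewrite ffunE scalerAl.
Qed.

HB.instance Definition _ := GRing.Lmodule_isLalgebra.Build R A cp_scaleAl.

Lemma cp_scaleAr (r : R) a b : r *: (a * b) = a * (r *: b).
Proof.
apply/ffunP => g; rewrite !ffunE scaler_sumr; apply: eq_bigr => h _.
by rewrite ffunE /sym_act /sym_map linearZ /= scalerAr.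
Qed.

HB.instance Definition _ := GRing.Lalgebra_isAlgebra.Build R A cp_scaleAr.

Definition cp_group g : A := cp_elt 1 g.
Definition cp_lin (x : 'rV[R]_n) : A := cp_elt (linform x) 1%g.

Lemma cp_group_lin g x :
  cp_group g * cp_lin x = cp_lin (dual_act g x) * cp_group g.
Proof.
apply/ffunP => h; rewrite [LHS]ffunE [RHS]ffunE.
rewrite (bigD1 g) //= big1 ?addr0 => [|k /negPf kg]; last first.
  by rewrite ffunE kg mul0r.
rewrite [RHS](bigD1 1%g) //= [X in _ = _ + X]big1 ?addr0 => [|k /negPf k1].
  rewrite !ffunE !eqxx mul1r invg1 mul1g sym_act1 -eq_mulVg1 eq_sym.
  rewrite /sym_act /sym_map.
  case: eqP => _; last by rewrite rmorph0 mulr0.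
  by rewrite mulr1 -/(sym_map _ _) sym_map_linform.
by rewrite ffunE k1 mul0r.
Qed.

End CrossedProduct.

Section Hochschild.
Variables (R : fieldType) (A : algType R).

Definition bilinear_op (m : A -> A -> A) : Prop :=
  (forall b, linear (m^~ b)) /\ (forall a, linear (m a)).

Definition cocycle2 (m : A -> A -> A) : Prop :=
  bilinear_op m /\
  forall a b c, a * m b c - m (a * b) c + m a (b * c) - m a b * c = 0.

Definition coboundary2 (phi : A -> A) (a b : A) : A :=
  a * phi b - phi (a * b) + phi a * b.

Definition cohomologous2 (m m' : A -> A -> A) : Prop :=
  exists2 phi : A -> A, linear phi
    & forall a b, m a b - m' a b = coboundary2 phi a b.

End Hochschild.

(* A[[hbar]] is nat -> A, s k being the coefficient of hbar^k in s.           *)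
Section FormalDeformation.
Variables (R : fieldType) (A : algType R).
Implicit Types (s t u : nat -> A) (c : nat -> R).

Definition ps_const (a : A) : nat -> A := fun k => if k == 0%N then a else 0.

Definition ps_add s t : nat -> A := fun k => s k + t k.

Definition ps_scale c s : nat -> A :=
  fun k => \sum_(i < k.+1) c i *: s (k - i)%N.

Definition ps_bilinear (star : (nat -> A) -> (nat -> A) -> nat -> A) : Prop :=
  (forall c s t u, star (ps_add (ps_scale c s) t) u
                     =1 ps_add (ps_scale c (star s u)) (star t u)) /\
  (forall c s t u, star u (ps_add (ps_scale c s) t)
                     =1 ps_add (ps_scale c (star u s)) (star u t)).

Definition star_coef star (k : nat) (a b : A) : A :=
  star (ps_const a) (ps_const b) k.

Definition star_product (star : (nat -> A) -> (nat -> A) -> nat -> A) : Prop :=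
  [/\ ps_bilinear star,
      forall s t u, star (star s t) u =1 star s (star t u)
    & forall a b, star_coef star 0 a b = a * b].

End FormalDeformation.

Section LinearPoisson.
Variables (R : realType) (gT : finGroupType) (n : nat).
Variable rG : mx_representation R [set: gT] n.
Variable ip : {dot 'cV[R]_n for idfun}.
Implicit Types (g : gT) (x y z : 'rV[R]_n).

Local Notation V := 'cV[R]_n.
Local Notation Vd := 'rV[R]_n.
Local Notation S := {mpoly R[n]}.

Definition invariant_form : Prop :=
  forall g (v w : V), ip (rG g *m v) (rG g *m w) = ip v w.

Definition fixsp g : {vspace V} := fixedSpace (linfun (mulmx (rG g) : V -> V)).

Definition normsp g : {vspace V} := orthov ip (fixsp g).

Definition codim g : nat := \dim (normsp g).

Definition colmx (f : 'End(V)) : 'M[R]_n :=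
  \matrix_(i, j) f (delta_mx j 0) i 0.

(* Matrices of the projections of V = V^g (+) N^g; x |-> x *m fixproj g and   *)
(* x |-> x *m normproj g are the projections of V^* = (V^g)^* (+) (N^g)^*.    *)
Definition fixproj g : 'M[R]_n := colmx (daddv_pi (fixsp g) (normsp g)).
Definition normproj g : 'M[R]_n := colmx (daddv_pi (normsp g) (fixsp g)).

(* Elements of S(V^* ) (x) /\^k V are viewed as alternating k-linear maps     *)
(* from V^* to S(V^* ). The component of f in /\^(k-l) V^g (x) /\^l N^g is    *)
(* obtained by summing over the sets J of l arguments that are projected to   *)
(* (N^g)^*, the others being projected to (V^g)^*. Restricting a polynomial   *)
(* to V^g, with (V^g)^* seen inside V^*, is sym_map (fixproj g).              *)
Definition pr g k (f : ('I_k -> Vd) -> S) (x : 'I_k -> Vd) : S :=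
  sym_map (fixproj g) (\sum_(J : {set 'I_k} | #|J| == codim g)
    f (fun i => x i *m (if i \in J then normproj g else fixproj g))).

Definition alternating2 (w : Vd -> Vd -> Vd) : Prop :=
  [/\ forall y, linear (w^~ y), forall x, linear (w x)
    & forall x, w x x = 0].

(* w lies in (V^g)^* (x) /\^2 N^g                                             *)
Definition supported_on_normal g (w : Vd -> Vd -> Vd) : Prop :=
  (forall x y v, v \in normsp g -> w x y *m v = 0) /\
  (forall x y, (forall v, v \in normsp g -> x *m v = 0) -> w x y = 0).

Variable pi : gT -> Vd -> Vd -> Vd.

Definition bracket g (x : 'I_3 -> Vd) : Vd :=
  \sum_(ab : gT * gT | (ab.1 * ab.2)%g == g)
    let t u v w := pi ab.1 (pi ab.2 u v) (w + dual_act rG ab.2 w) in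
    t (x 0) (x 1) (x 2) + t (x 1) (x 2) (x 0) + t (x 2) (x 0) (x 1).

Record linear_poisson : Prop := {
  linear_poisson_alt : forall g, alternating2 (pi g);
  linear_poisson_supp : forall g, codim g = 2%N ->
    supported_on_normal g (pi g);
  linear_poisson_zero : forall g, g != 1%g -> codim g <> 2%N ->
    forall x y, pi g x y = 0;
  linear_poisson_inv : forall h g x y,
    pi (h * g * h^-1)%g (dual_act rG h x) (dual_act rG h y)
      = dual_act rG h (pi g x y);
  linear_poisson_bracket : forall g (x : 'I_3 -> Vd),
    pr g (fun xs : 'I_3 -> Vd => linform (bracket g xs)) x = 0
}.

Local Notation A := (crossed_product rG).

Definition group_bilinear (m : A -> A -> A) : Prop :=
  forall g a b, [/\ m (cp_group rG g * a) b = cp_group rG g * m a b,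
                    m (a * cp_group rG g) b = m a (cp_group rG g * b)
                  & m a (b * cp_group rG g) = m a b * cp_group rG g].

(* f_g(x_0, x_1), where m x_0 x_1 - m x_1 x_0 = \sum_g f_g(x_0, x_1) g        *)
Definition skew_part (m : A -> A -> A) g (x : 'I_2 -> Vd) : S :=
  (m (cp_lin rG (x 0)) (cp_lin rG (x 1))
     - m (cp_lin rG (x 1)) (cp_lin rG (x 0)) : {ffun gT -> S}) g.

(* The class of the Hochschild 2-cocycle m1 in H^2(A, A) is pi.               *)
Definition has_class (m1 : A -> A -> A) : Prop :=
  exists m : A -> A -> A,
    [/\ cocycle2 m, group_bilinear m, cohomologous2 m1 m
      & forall g (x : 'I_2 -> Vd),
          pr g (skew_part m g) x = linform (pi g (x 0) (x 1))].

Definition quantizable : Prop :=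
  exists star : (nat -> A) -> (nat -> A) -> nat -> A,
    star_product star /\ has_class (star_coef star 1).

End LinearPoisson.

(* Main.v *)
Require Import Defs.
From mathcomp Require Import all_boot all_order all_algebra all_fingroup.
From mathcomp Require Import mxrepresentation sesquilinear mpoly reals.
From mathcomp Require Import ring zify.

(** The quantization is the algebra generated over [R[[hbar]]] by the linear
    forms and the group elements, with [g x = (g x) g] and the relations
    [x y - y x = hbar \sum_g pi_g(x, y) g]. What has to be shown is that it is
    as large as [A[[hbar]]]: a statement of Poincare-Birkhoff-Witt type.

    The relations are consistent as soon as two cyclic sums over [x, y, z]
    vanish: that of [pi_g(y, z) (x) (g x - x)] for every [g], and that of
    [\sum_(ab = g) pi_a(pi_b(y, z), x)]. The first one is alternating and only
    depends on components in the dual of a plane, the space normal to [g], so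
    it is zero ([pi_shift_eq0]). Given the first, the second is half of the
    bracket of [pi] with itself, of which only the projections are known to
    vanish. Here the group being abelian comes in: the projections onto the
    normal spaces of [a] and [b] commute, and looking at how two planes with
    this property can meet shows that [pi_a] and [pi_b] do not interact when
    [a] and [b] both have codimension 2 ([pi_pi_eq0]). The terms that remain
    involve [pi_1], and they are all seen by the projection ([bracket_eq0],
    [pi_jacobi_eq0]).

    For the size of the algebra, [hbar] is set to 1 and recovered at the end
    from the degree. The left multiplication by a linear form [v] is looked
    for as an operator [X_v a = v a + E_v a] on [A], where [E_v] does not
    raise the degree. The relation for [X_v X_w - X_w X_v] prescribes the
    Koszul coboundary [E_v (w a) - E_w (v a)] in terms of [E] in lower degree.
    In characteristic 0 the Koszul complex has an explicit contraction, so
    that [E] can be defined recursively by contracting the prescribed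
    coboundary; this works because the latter is a cocycle, by the two cyclic
    identities ([defect_cocycle], [left_mult_commutator]). The product of [a]
    and [b] is then defined by writing [a] through the Euler identity as a sum
    of products with linear forms, which are made to act by the [X_v].
    Uniqueness in the same contraction gives [X_v (a b) = (X_v a) b] for this
    product ([filtered_prod_left_mult]), and associativity follows by
    induction on the degree of [a].

    The contraction commutes with the group, so each coefficient of the
    resulting star product is bilinear over the group algebra. Thus its first
    coefficient is itself a cocycle of the kind that computes the class, and
    its skew part is [\sum_g pi_g(x, y) g]. *)

Set Implicit Arguments.
Unset Strict Implicit.
Unset Printing Implicit Defensive.

Import Order.TTheory GRing.Theory Num.Theory.

Local Open Scope ring_scope.

(** * Linear maps given as predicates *)

Section LinearProp.
Variables (R : pzRingType) (U V W : lmodType R).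

Lemma linearD_prop (f : U -> V) : linear f -> {morph f : x y / x + y}.
Proof. by move=> fL x y; have := fL 1 x y; rewrite !scale1r. Qed.

Lemma linear0_prop (f : U -> V) : linear f -> f 0 = 0.
Proof.
by move=> fL; apply: (addrI (f 0)); rewrite -linearD_prop // !addr0.
Qed.

Lemma linearZ_prop (f : U -> V) : linear f -> forall c, {morph f : x / c *: x}.
Proof.
by move=> fL c x; rewrite -[c *: x]addr0 fL linear0_prop // addr0.
Qed.

Lemma linearN_prop (f : U -> V) : linear f -> {morph f : x / - x}.
Proof. by move=> fL x; rewrite -scaleN1r linearZ_prop // scaleN1r. Qed.

Lemma linearB_prop (f : U -> V) : linear f -> {morph f : x y / x - y}.
Proof. by move=> fL x y; rewrite linearD_prop // linearN_prop. Qed.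

Lemma linear_sum_prop (f : U -> V) : linear f ->
  forall I r (P : pred I) (F : I -> U),
  f (\sum_(i <- r | P i) F i) = \sum_(i <- r | P i) f (F i).
Proof.
by move=> fL I r P F; apply: (big_morph f (linearD_prop fL) (linear0_prop fL)).
Qed.

Lemma linear_add (f g : U -> V) :
  linear f -> linear g -> linear (fun x => f x + g x).
Proof. by move=> fL gL c x y; rewrite fL gL scalerDr addrACA. Qed.

Lemma linear_opp (f : U -> V) : linear f -> linear (fun x => - f x).
Proof. by move=> fL c x y; rewrite fL opprD scalerN. Qed.

Lemma linear_sub (f g : U -> V) :
  linear f -> linear g -> linear (fun x => f x - g x).
Proof. by move=> fL gL; apply: linear_add => //; apply: linear_opp. Qed.

Lemma linear_bigsum I (r : seq I) (P : pred I) (f : I -> U -> V) :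
  (forall i, linear (f i)) -> linear (fun x => \sum_(i <- r | P i) f i x).
Proof.
move=> fL c x y; rewrite scaler_sumr -big_split.
by apply: eq_bigr => i _; rewrite fL.
Qed.

Lemma linear_comp (f : V -> W) (g : U -> V) :
  linear f -> linear g -> linear (fun x => f (g x)).
Proof. by move=> fL gL c x y; rewrite gL fL. Qed.

End LinearProp.

(** * Euler identity and linear substitutions for polynomials *)

Section PolynomialCalculus.
Variables (R : numFieldType) (n : nat).
Implicit Types (p q : {mpoly R[n]}) (m : 'X_{1..n}) (v w : 'rV[R]_n).

Lemma linear_ext_mpoly (W : lmodType R) (f g : {mpoly R[n]} -> W) :
  linear f -> linear g -> (forall m, f 'X_[m] = g 'X_[m]) -> f =1 g.
Proof.
move=> fL gL fg p; rewrite [p]mpolyE !linear_sum_prop //.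
by apply: eq_bigr => m _; rewrite !linearZ_prop // fg.
Qed.

(** Division by [d + c] in degree [d]. For [c = 0] the constants are sent to
    [0], in accordance with [0^-1 = 0]. *)
Definition rescale (c : nat) p : {mpoly R[n]} :=
  \sum_(m <- msupp p) (p@_m / (mdeg m + c)%:R) *: 'X_[m].

Lemma mcoeff_rescale c p m : (rescale c p)@_m = p@_m / (mdeg m + c)%:R.
Proof.
rewrite /rescale linear_sum /=.
under eq_bigr => k _ do rewrite mcoeffZ mcoeffX.
have [mp|mp] := boolP (m \in msupp p).
  rewrite (bigD1_seq m) ?msupp_uniq //= eqxx mulr1 big1 ?addr0 // => k /negPf.
  by move=> ->; rewrite mulr0.
rewrite (memN_msupp_eq0 mp) mul0r big_seq big1 // => k kp.
by case: eqP => [km|_]; rewrite ?mulr0 //; rewrite -km kp in mp.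
Qed.

Lemma rescale_linear c : linear (rescale c).
Proof.
move=> a p q; apply/mpolyP => m.
by rewrite mcoeffD mcoeffZ !mcoeff_rescale mcoeffD mcoeffZ mulrDl mulrA.
Qed.

Lemma rescale_mono c m : rescale c 'X_[m] = (mdeg m + c)%:R^-1 *: 'X_[m].
Proof.
apply/mpolyP => k; rewrite mcoeff_rescale mcoeffZ mcoeffX.
by case: eqP => [->|_]; rewrite ?mul1r ?mulr1 ?mul0r ?mulr0.
Qed.

Lemma mderiv_linear i : linear (@mderiv n R i).
Proof. by move=> c p q; rewrite mderivD mderivZ. Qed.

Lemma mul_linear p : linear (fun q : {mpoly R[n]} => p * q).
Proof. by move=> c x y; rewrite mulrDr scalerAr. Qed.

(** Multiplication by a linear form raises the degree by one. *)
Lemma rescale_mul c v p :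
  rescale c (linform v * p) = linform v * rescale c.+1 p.
Proof.
move: p; apply: linear_ext_mpoly.
- by apply: linear_comp; [apply: rescale_linear|apply: mul_linear].
- by apply: linear_comp; [apply: mul_linear|apply: rescale_linear].
move=> m; rewrite rescale_mono -scalerAr /linform mulr_suml.
rewrite linear_sum_prop ?scaler_sumr; last exact: rescale_linear.
apply: eq_bigr => i _; rewrite -scalerAl -mpolyXD linearZ_prop; last first.
  exact: rescale_linear.
by rewrite rescale_mono mdegD mdeg1 add1n addSnnS scalerA [RHS]scalerA mulrC.
Qed.

Lemma mderiv_linform i v : (linform v)^`M(i) = (v 0 i)%:MP.
Proof.
rewrite linear_sum_prop; last exact: mderiv_linear.
rewrite (bigD1 i) //= big1 => [|j /negPf ji].
  rewrite addr0 mderivZ mderivX mnmE eqxx scale1r.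
  have -> : (U_(i) - U_(i) = 0 :> 'X_{1..n})%MM.
    by apply/mnmP => k; rewrite !mnmE subnn.
  by rewrite mpolyX0 alg_mpolyC.
by rewrite mderivZ mderivX mnmE ji scale0r scaler0.
Qed.

Lemma mderiv_linformM i v p :
  (linform v * p)^`M(i) = linform v * p^`M(i) + v 0 i *: p.
Proof. by rewrite mderivM mderiv_linform mul_mpolyC addrC. Qed.

Lemma mulX_mderiv i m :
  'X_i * ('X_[m])^`M(i) = (m i)%:R *: 'X_[m] :> {mpoly R[n]}.
Proof.
rewrite mderivX -scalerAr -mpolyXD.
have [->|mi] := eqVneq (m i) 0%N; first by rewrite !scale0r.
congr (_ *: 'X_[_]); apply/mnmP => j; rewrite !mnmE.
by case: eqP => [<-|]; rewrite ?subn0 // addnC subnK // lt0n.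
Qed.

Lemma euler_rescale_mono c m :
  \sum_i 'X_i * rescale c.+1 ('X_[m])^`M(i)
    = ((mdeg m)%:R / (mdeg m + c)%:R) *: 'X_[m] :> {mpoly R[n]}.
Proof.
under eq_bigr => i _ do
  rewrite -linform_delta -rescale_mul linform_delta mulX_mderiv.
rewrite -linear_sum_prop; last exact: rescale_linear.
rewrite -scaler_suml -natr_sum -mdegE linearZ_prop; last exact: rescale_linear.
by rewrite rescale_mono scalerA.
Qed.

(** This is the Euler identity [\sum_i x_i d_i p = d p] in degree [d], divided
    by [d + c]. *)
Lemma euler_rescale c p : (0 < c)%N ->
  \sum_i 'X_i * rescale c.+1 p^`M(i) + c%:R *: rescale c p = p.
Proof.
move=> c0; move: p; apply: (@linear_ext_mpoly _ _ id); last first.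
- move=> m; rewrite euler_rescale_mono rescale_mono scalerA -scalerDl -mulrDl.
  rewrite -natrD divff ?scale1r //.
  by rewrite pnatr_eq0 addn_eq0 negb_and -!lt0n c0 orbT.
- by [].
apply: linear_add.
  apply: linear_bigsum => i; apply: linear_comp; first exact: mul_linear.
  by apply: linear_comp; [apply: rescale_linear|apply: mderiv_linear].
by move=> a x y; rewrite rescale_linear scalerDr !scalerA mulrC.
Qed.

Lemma euler_rescale0 p :
  \sum_i 'X_i * rescale 1 p^`M(i) + pihomog mdeg 0 p = p.
Proof.
move: p; apply: (@linear_ext_mpoly _ _ id); last first.
- move=> m; rewrite euler_rescale_mono pihomogX addn0.
  have [->|m0] := eqVneq (mdeg m) 0%N; first by rewrite mul0r scale0r add0r.
  by rewrite divff ?pnatr_eq0 // scale1r addr0.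
- by [].
apply: linear_add; last exact: pihomog_is_linear.
apply: linear_bigsum => i; apply: linear_comp; first exact: mul_linear.
by apply: linear_comp; [apply: rescale_linear|apply: mderiv_linear].
Qed.

Lemma pihomog0E p : pihomog mdeg 0 p = (p@_0)%:MP.
Proof.
move: p; apply: linear_ext_mpoly => [|c p q|m]; first exact: pihomog_is_linear.
  by rewrite mcoeffD mcoeffZ mpolyCD mpolyCM mul_mpolyC.
rewrite pihomogX mcoeffX mdeg_eq0.
by case: eqP => [->|_]; rewrite ?mpolyX0.
Qed.

Lemma sym_map_linear (M : 'M[R]_n) : linear (sym_map M).
Proof. by move=> c p q; rewrite /sym_map linearP. Qed.

Lemma sym_mapM (M : 'M[R]_n) : {morph sym_map M : p q / p * q}.
Proof. by move=> p q; rewrite /sym_map rmorphM. Qed.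

(** Both sides are derivations along [sym_map M], so that it is enough to
    compare them on the variables: this is the chain rule for a linear
    substitution. *)
Lemma mderiv_sym_map j (M : 'M[R]_n) p :
  (sym_map M p)^`M(j) = \sum_i M i j *: sym_map M p^`M(i).
Proof.
move: p; apply: linear_ext_mpoly.
- by apply: linear_comp; [apply: mderiv_linear|apply: sym_map_linear].
- apply: linear_bigsum => i c p q.
  by rewrite mderiv_linear sym_map_linear scalerDr !scalerA mulrC.
pose P p := (sym_map M p)^`M(j) = \sum_i M i j *: sym_map M p^`M(i).
have PM p q : P p -> P q -> P (p * q).
  rewrite /P => Pp Pq; rewrite sym_mapM mderivM Pp Pq mulr_suml mulr_sumr.
  rewrite -big_split; apply: eq_bigr => i _ /=.
  rewrite mderivM (linearD_prop (sym_map_linear M)) !sym_mapM scalerDr.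
  by rewrite -scalerAl -scalerAr.
have P1 : P 1.
  rewrite /P {1}/sym_map rmorph1 -mpolyC1 mderivC big1 // => i _.
  by rewrite mderivC /sym_map rmorph0 scaler0.
move=> m; rewrite -/(P 'X_[m]) mpolyXE_id; apply: big_ind => // i _.
elim: (m i) => [|k IHk]; first by rewrite expr0.
rewrite exprS; apply: PM => //; rewrite /P sym_mapX mderiv_linform.
rewrite (bigD1 i) //= big1 => [|k' /negPf ki].
  rewrite -linform_delta mderiv_linform addr0 !mxE !eqxx /= mpolyC1.
  by rewrite /sym_map rmorph1 alg_mpolyC.
by rewrite -linform_delta mderiv_linform mxE ki andbF /sym_map rmorph0 scaler0.
Qed.

Lemma linform_homog v : linform v \is 1.-homog.
Proof. by apply: rpred_sum => i _; apply: rpredZ; rewrite dhomogX /= mdeg1. Qed.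

Lemma sym_map_mono_homog (M : 'M[R]_n) m : sym_map M 'X_[m] \is (mdeg m).-homog.
Proof.
rewrite /sym_map comp_mpolyX mdegE.
apply: (big_ind2 (fun p d => p \is d.-homog)) => [||i _]; first exact: dhomog1.
  by move=> p d q e; apply: dhomogM.
by rewrite tnth_mktuple -[X in X.-homog]mul1n; apply/dhomogMn/linform_homog.
Qed.

Lemma rescale_homog c d p : p \is d.-homog ->
  rescale c p = (d + c)%:R^-1 *: p.
Proof.
move=> pd; apply/mpolyP => m; rewrite mcoeff_rescale mcoeffZ mulrC.
have [->//|md] := eqVneq (mdeg m) d.
by rewrite (dhomog_nemf_coeff pd) // !mulr0.
Qed.

Lemma rescale_sym_map c (M : 'M[R]_n) p :
  rescale c (sym_map M p) = sym_map M (rescale c p).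
Proof.
move: p; apply: linear_ext_mpoly => [||m].
- by apply: linear_comp; [apply: rescale_linear|apply: sym_map_linear].
- by apply: linear_comp; [apply: sym_map_linear|apply: rescale_linear].
rewrite (rescale_homog _ (sym_map_mono_homog M m)) rescale_mono.
by rewrite linearZ_prop //; apply: sym_map_linear.
Qed.

Lemma pihomog_sym_map d (M : 'M[R]_n) p :
  pihomog mdeg d (sym_map M p) = sym_map M (pihomog mdeg d p).
Proof.
move: p; apply: linear_ext_mpoly => [||m].
- by apply: linear_comp; [apply: pihomog_is_linear|apply: sym_map_linear].
- by apply: linear_comp; [apply: sym_map_linear|apply: pihomog_is_linear].
rewrite pihomogX; case: eqP => [<-|/eqP md].
  by rewrite pihomog_dE // sym_map_mono_homog.
rewrite (pihomog_ne0 md (sym_map_mono_homog M m)).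
by rewrite linear0_prop //; apply: sym_map_linear.
Qed.

Lemma msize_leP k p :
  reflect (forall m, (k <= mdeg m)%N -> p@_m = 0) (msize p <= k)%N.
Proof.
apply: (iffP idP) => [pk m km|pk].
  by apply: memN_msupp_eq0; apply: msize_mdeg_ge; apply: leq_trans km.
rewrite msizeE; apply/bigmax_leqP_seq => m mp _; rewrite ltnNge.
by apply/negP => /pk /eqP; rewrite mcoeff_eq0 mp.
Qed.

Lemma msize_mul_homog k d p q :
  p \is d.-homog -> (msize q <= k)%N -> (msize (p * q) <= d + k)%N.
Proof.
move=> /dhomogP pd qk; rewrite msizeE; apply/bigmax_leqP_seq => m.
move=> /msuppM_le /allpairsP [[m1 m2] /= [m1p m2q ->]] _.
rewrite mdegD -addnS; have /= -> := pd _ m1p.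
by rewrite leq_add2l; apply: leq_trans (msize_mdeg_lt m2q) qk.
Qed.

Lemma msize_mul j k p q : (msize p <= j.+1)%N -> (msize q <= k.+1)%N ->
  (msize (p * q) <= (j + k).+1)%N.
Proof.
move=> pj qk; rewrite msizeE; apply/bigmax_leqP_seq => m.
move=> /msuppM_le /allpairsP [[m1 m2] /= [m1p m2q ->]] _.
rewrite mdegD ltnS leq_add // -ltnS.
  exact: leq_trans (msize_mdeg_lt m1p) pj.
exact: leq_trans (msize_mdeg_lt m2q) qk.
Qed.

Lemma msize_sym_map k (M : 'M[R]_n) p :
  (msize p <= k)%N -> (msize (sym_map M p) <= k)%N.
Proof.
move=> pk; apply/msize_leP => m km.
rewrite [p]mpolyE (linear_sum_prop (sym_map_linear M)) linear_sum /= big_seq.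
rewrite big1 // => l lp; rewrite (linearZ_prop (sym_map_linear M)) mcoeffZ.
rewrite (dhomog_nemf_coeff (sym_map_mono_homog M l)) ?mulr0 //.
by rewrite gtn_eqF //; apply: leq_trans (msize_mdeg_lt lp) (leq_trans pk km).
Qed.

End PolynomialCalculus.

(** * Calculus in the crossed product *)

Section CrossedProductCalculus.
Variables (R : numFieldType) (gT : finGroupType) (n : nat).
Variable rG : mx_representation R [set: gT] n.
Local Notation A := (crossed_product rG).
Local Notation Vd := 'rV[R]_n.
Implicit Types (a b c : A) (v w : Vd) (g h : gT).
Implicit Type f : {mpoly R[n]} -> {mpoly R[n]}.

Definition cp_map f a : A := [ffun g => f (a g)].

Definition cp_deriv i : A -> A := cp_map (mderiv i).
Definition cp_rescale k : A -> A := cp_map (rescale k).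
Definition cp_homog d : A -> A := cp_map (pihomog mdeg d).

(** The bound is strict, so that only [0] satisfies it for [k = 0]: this is the
    base case of the inductions on the degree. *)
Definition cp_deg_lt k a : Prop := forall g, (msize (a g) <= k)%N.

Lemma cp_map_linear f : linear f -> linear (cp_map f).
Proof. by move=> fL c a b; apply/ffunP => g; rewrite !ffunE fL. Qed.

Lemma cp_deriv_linear i : linear (cp_deriv i).
Proof. exact/cp_map_linear/mderiv_linear. Qed.

Lemma cp_rescale_linear k : linear (cp_rescale k).
Proof. exact/cp_map_linear/rescale_linear. Qed.

Lemma cp_homog_linear d : linear (cp_homog d).
Proof. exact/cp_map_linear/pihomog_is_linear. Qed.

Lemma cp_lin_linear : linear (cp_lin rG).
Proof.
move=> c v w; apply/ffunP => g; rewrite !ffunE linearP /=.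
by case: eqP => _; rewrite ?scaler0 ?addr0.
Qed.

Lemma mulr_linear a : linear (fun b : A => a * b).
Proof. by move=> c x y; rewrite mulrDr scalerAr. Qed.

Lemma mull_linear a : linear (fun b : A => b * a).
Proof. by move=> c x y; rewrite mulrDl scalerAl. Qed.

Lemma cp_linE v a g : (cp_lin rG v * a) g = linform v * a g.
Proof.
rewrite [LHS]ffunE (bigD1 1%g) //= big1 ?addr0 => [|k /negPf k1].
  by rewrite ffunE eqxx sym_act1 invg1 mul1g.
by rewrite ffunE k1 mul0r.
Qed.

Lemma cp_groupE g a h : (cp_group rG g * a) h = sym_act rG g (a (g^-1 * h)%g).
Proof.
rewrite [LHS]ffunE (bigD1 g) //= big1 ?addr0 => [|k /negPf k1].
  by rewrite ffunE eqxx mul1r.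
by rewrite ffunE k1 mul0r.
Qed.

Lemma mul_groupE g a h : (a * cp_group rG g) h = a (h * g^-1)%g.
Proof.
rewrite [LHS]ffunE (bigD1 (h * g^-1)%g) //= big1 ?addr0 => [|k /negPf k1].
  rewrite ffunE invMg invgK mulgKV eqxx.
  by rewrite /sym_act /sym_map rmorph1 mulr1.
rewrite ffunE; case: eqP => [kg|_].
  by case/eqP: k1; rewrite -kg invMg invgK mulKVg.
by rewrite /sym_act /sym_map rmorph0 mulr0.
Qed.

Lemma cp_groupM g h : cp_group rG g * cp_group rG h = cp_group rG (g * h)%g.
Proof.
apply/ffunP => k; rewrite cp_groupE !ffunE -(inj_eq (mulgI g)) mulKVg.
by case: eqP => _; rewrite /sym_act /sym_map ?rmorph1 ?rmorph0.
Qed.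

Lemma cp_linC v w a :
  cp_lin rG v * (cp_lin rG w * a) = cp_lin rG w * (cp_lin rG v * a).
Proof. by apply/ffunP => g; rewrite !cp_linE [LHS]mulrCA. Qed.

Lemma cp_groupC g v a :
  cp_group rG g * (cp_lin rG v * a)
    = cp_lin rG (dual_act rG g v) * (cp_group rG g * a).
Proof. by rewrite !mulrA cp_group_lin. Qed.

Lemma cp_deriv_lin i v a :
  cp_deriv i (cp_lin rG v * a) = cp_lin rG v * cp_deriv i a + v 0 i *: a.
Proof.
by apply/ffunP => g; rewrite !(cp_linE, ffunE) mderiv_linformM.
Qed.

Lemma cp_rescale_lin k v a :
  cp_rescale k (cp_lin rG v * a) = cp_lin rG v * cp_rescale k.+1 a.
Proof. by apply/ffunP => g; rewrite !(cp_linE, ffunE) rescale_mul. Qed.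

Lemma cp_euler k a : (0 < k)%N ->
  \sum_i cp_lin rG (delta_mx 0 i) * cp_rescale k.+1 (cp_deriv i a)
    + k%:R *: cp_rescale k a = a.
Proof.
move=> k0; apply/ffunP => g.
rewrite -[RHS](euler_rescale _ k0) !ffunE sum_ffunE.
congr (_ + _); apply: eq_bigr => i _.
by rewrite cp_linE linform_delta !ffunE.
Qed.

Lemma cp_euler0 a :
  \sum_i cp_lin rG (delta_mx 0 i) * cp_rescale 1 (cp_deriv i a)
    + cp_homog 0 a = a.
Proof.
apply/ffunP => g; rewrite -[RHS]euler_rescale0 !ffunE sum_ffunE.
congr (_ + _); apply: eq_bigr => i _.
by rewrite cp_linE linform_delta !ffunE.
Qed.

Lemma cp_map_mul_group f a g :
  cp_map f (a * cp_group rG g) = cp_map f a * cp_group rG g.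
Proof. by apply/ffunP => h; rewrite ffunE !mul_groupE ffunE. Qed.

Lemma cp_rescale_group k g a :
  cp_rescale k (cp_group rG g * a) = cp_group rG g * cp_rescale k a.
Proof.
by apply/ffunP => h; rewrite ffunE !cp_groupE ffunE [LHS]rescale_sym_map.
Qed.

Lemma cp_homog_group d g a :
  cp_homog d (cp_group rG g * a) = cp_group rG g * cp_homog d a.
Proof.
by apply/ffunP => h; rewrite ffunE !cp_groupE ffunE [LHS]pihomog_sym_map.
Qed.

Lemma cp_deriv_group j g a :
  cp_deriv j (cp_group rG g * a)
    = \sum_i rG g^-1%g i j *: (cp_group rG g * cp_deriv i a).
Proof.
apply/ffunP => h; rewrite ffunE cp_groupE mderiv_sym_map sum_ffunE.
by apply: eq_bigr => i _; rewrite ffunE cp_groupE ffunE.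
Qed.

(** The operator [\sum_i x_i d_i] comes from the canonical element of the tensor
    product of [V] and its dual, hence commutes with the group. This makes all
    the constructions below equivariant. *)
Lemma sum_deriv_group (W : lmodType R) (B : Vd -> A -> W) g a :
  (forall b, linear (B^~ b)) -> (forall v, linear (B v)) ->
  \sum_i B (dual_act rG g (delta_mx 0 i)) (cp_group rG g * cp_deriv i a)
    = \sum_j B (delta_mx 0 j) (cp_deriv j (cp_group rG g * a)).
Proof.
move=> Bl Br; have E i: dual_act rG g (delta_mx 0 i)
  = \sum_j rG g^-1%g i j *: delta_mx 0 j.
  rewrite [LHS]row_sum_delta; apply: eq_bigr => j _; congr (_ *: _).
  by rewrite /dual_act -rowE mxE.
under eq_bigr => i _ do rewrite E (linear_sum_prop (Bl _)).
rewrite exchange_big; apply: eq_bigr => j _ /=.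
rewrite cp_deriv_group (linear_sum_prop (Br _)).
by apply: eq_bigr => i _; rewrite (linearZ_prop (Bl _)) (linearZ_prop (Br _)).
Qed.

Lemma sum_delta (W : lmodType R) (f : Vd -> W) v : linear f ->
  f v = \sum_i v 0 i *: f (delta_mx 0 i).
Proof.
move=> fL; rewrite {1}[v]row_sum_delta linear_sum_prop //.
by apply: eq_bigr => i _; rewrite linearZ_prop.
Qed.

Lemma cp_deg_lt0 a : cp_deg_lt 0 a -> a = 0.
Proof.
move=> a0; apply/ffunP => g; rewrite ffunE; apply/eqP.
by rewrite -(mmeasure_poly_eq0 mdeg) -leqn0 a0.
Qed.

Lemma cp_deg_ltW k l a : (k <= l)%N -> cp_deg_lt k a -> cp_deg_lt l a.
Proof. by move=> kl ak g; apply: leq_trans kl. Qed.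

Lemma cp_deg_ltP k a :
  cp_deg_lt k a <-> (forall g m, (k <= mdeg m)%N -> (a g)@_m = 0).
Proof. by split=> ak g; apply/msize_leP/ak. Qed.

Lemma cp_deg_lt_0 k : cp_deg_lt k 0.
Proof. by move=> g; rewrite ffunE mmeasure0. Qed.

Lemma cp_deg_lt_lincomb k (r : R) a b :
  cp_deg_lt k a -> cp_deg_lt k b -> cp_deg_lt k (r *: a + b).
Proof.
move=> /cp_deg_ltP ak /cp_deg_ltP bk; apply/cp_deg_ltP => g m km.
by rewrite !ffunE mcoeffD mcoeffZ ak // bk // mulr0 addr0.
Qed.

Lemma cp_deg_ltD k a b : cp_deg_lt k a -> cp_deg_lt k b -> cp_deg_lt k (a + b).
Proof. by move=> ak bk; rewrite -[a]scale1r; apply: cp_deg_lt_lincomb. Qed.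

Lemma cp_deg_ltB k a b : cp_deg_lt k a -> cp_deg_lt k b -> cp_deg_lt k (a - b).
Proof. by move=> ak bk; rewrite addrC -scaleN1r; apply: cp_deg_lt_lincomb. Qed.

Lemma cp_deg_lt_sum k I (r : seq I) (P : pred I) (F : I -> A) :
  (forall i, cp_deg_lt k (F i)) -> cp_deg_lt k (\sum_(i <- r | P i) F i).
Proof.
move=> Fk; apply: big_ind => // [|a b]; first exact: cp_deg_lt_0.
exact: cp_deg_ltD.
Qed.

Lemma cp_deg_lt_bound a : exists k, cp_deg_lt k a.
Proof. by exists (\max_g msize (a g)) => g; apply: leq_bigmax. Qed.

Lemma cp_deg_lt_rescale k l a : cp_deg_lt k a -> cp_deg_lt k (cp_rescale l a).
Proof.
move=> /cp_deg_ltP ak; apply/cp_deg_ltP => g m km.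
by rewrite ffunE mcoeff_rescale ak // mul0r.
Qed.

Lemma cp_deg_lt_deriv k i a : cp_deg_lt k.+1 a -> cp_deg_lt k (cp_deriv i a).
Proof.
move=> /cp_deg_ltP ak; apply/cp_deg_ltP => g m km.
by rewrite ffunE mcoeff_mderiv ak ?mul0rn // mdegD mdeg1 addn1.
Qed.

Lemma cp_deg_lt_lin k v a : cp_deg_lt k a -> cp_deg_lt k.+1 (cp_lin rG v * a).
Proof.
by move=> ak g; rewrite cp_linE; apply: (msize_mul_homog (linform_homog v)).
Qed.

Lemma cp_deg_lt_group k g a : cp_deg_lt k a -> cp_deg_lt k (cp_group rG g * a).
Proof. by move=> ak h; rewrite cp_groupE; apply: msize_sym_map. Qed.

Lemma cp_deg_lt_mul_group k g a :
  cp_deg_lt k a -> cp_deg_lt k (a * cp_group rG g).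
Proof. by move=> ak h; rewrite mul_groupE. Qed.

Lemma cp_deg_lt_mul j k a b :
  cp_deg_lt j.+1 a -> cp_deg_lt k.+1 b -> cp_deg_lt (j + k).+1 (a * b).
Proof.
move=> aj bk g; rewrite ffunE; elim/big_ind: _ => [|p q pk qk|h _].
- by rewrite mmeasure0.
- by apply: leq_trans (mmeasureD_le _ _ _) _; rewrite geq_max pk.
- by apply: msize_mul => //; apply: msize_sym_map.
Qed.

Lemma cp_homog_deg d a : cp_deg_lt d.+1 (cp_homog d a).
Proof.
apply/cp_deg_ltP => g m dm; rewrite ffunE.
by rewrite (dhomog_nemf_coeff (pihomogP _ _ _)) //= gtn_eqF.
Qed.

Lemma cp_homog_sum k a : cp_deg_lt k a -> a = \sum_(d < k) cp_homog d a.
Proof.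
move=> ak; apply/ffunP => g; rewrite sum_ffunE.
rewrite {1}(pihomog_partitionE (mf := mdeg) (ak g)).
by apply: eq_bigr => d _; rewrite ffunE.
Qed.

Lemma cp_homog_homog d e a :
  cp_homog d (cp_homog e a) = if e == d then cp_homog e a else 0.
Proof.
apply/ffunP => g; rewrite !ffunE; case: eqP => [->|/eqP ed].
  by rewrite ffunE pihomog_id.
by rewrite ffunE (pihomog_ne0 ed) // pihomogP.
Qed.

Lemma cp_homog_id d a : cp_homog d (cp_homog d a) = cp_homog d a.
Proof. by rewrite cp_homog_homog eqxx. Qed.

Lemma cp_homog_eq0 k d a : (k <= d)%N -> cp_deg_lt k a -> cp_homog d a = 0.
Proof.
move=> kd /cp_homog_sum ->.
rewrite (linear_sum_prop (@cp_homog_linear d)) big1 // => e _.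
by rewrite cp_homog_homog ltn_eqF // (leq_trans _ kd).
Qed.

Lemma cp_homog_mul d e a b : cp_homog d a = a -> cp_homog e b = b ->
  cp_homog (d + e) (a * b) = a * b.
Proof.
move=> ad be; apply/ffunP => g; rewrite !ffunE linear_sum /=.
apply: eq_bigr => h _; apply: pihomog_dE; apply: dhomogM.
  by rewrite -ad ffunE pihomogP.
by rewrite -be ffunE /sym_act -pihomog_sym_map pihomogP.
Qed.

End CrossedProductCalculus.

(** * Linear maps defined by recursion on the degree *)

Section DegreewiseLimit.
Variables (R : numFieldType) (gT : finGroupType) (n : nat).
Variable rG : mx_representation R [set: gT] n.
Local Notation A := (crossed_product rG).
Variables (W : lmodType R) (T : nat -> A -> W).
Hypothesis T_linear : forall k, linear (T k).
Hypothesis T_stable : forall k a, cp_deg_lt k a -> T k.+1 a = T k a.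

(** The common value of [T k a] for all [k] above the degree of [a]. *)
Definition cp_limit (a : A) : W := T (\max_g msize (a g)) a.

Lemma cp_limitE k a : cp_deg_lt k a -> cp_limit a = T k a.
Proof.
have stable l m b : cp_deg_lt l b -> T (m + l) b = T l b.
  move=> bl; elim: m => // m IHm; rewrite -IHm T_stable //.
  by apply: cp_deg_ltW bl; rewrite leq_addl.
move=> ak; rewrite /cp_limit; set s := \max_g _.
have as_ : cp_deg_lt s a by move=> g; apply: leq_bigmax.
have sk : (s <= k)%N by apply/bigmax_leqP => g _; apply: ak.
by rewrite -(subnK sk) stable.
Qed.

Lemma cp_limit_linear : linear cp_limit.
Proof.
move=> c a b; have [k ak] := cp_deg_lt_bound a.
have [l bl] := cp_deg_lt_bound b.
have am := cp_deg_ltW (leq_maxl k l) ak.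
have bm := cp_deg_ltW (leq_maxr k l) bl.
rewrite (cp_limitE am) (cp_limitE bm) (cp_limitE (cp_deg_lt_lincomb c am bm)).
exact: T_linear.
Qed.

End DegreewiseLimit.

(** * The contraction of the Koszul complex *)

Section KoszulContraction.
Variables (R : numFieldType) (gT : finGroupType) (n : nat).
Variable rG : mx_representation R [set: gT] n.
Local Notation A := (crossed_product rG).
Local Notation Vd := 'rV[R]_n.
Local Notation "v .* a" := (cp_lin rG v * (a : A)) (at level 40).
Local Notation x_ i := (delta_mx 0 i : Vd).
Variable W : lmodType R.

(** A bilinear [F v a] is a 1-cochain of the Koszul complex of the symmetric
    algebra, with coboundary [F v (w a) - F w (v a)], and an alternating
    [C v w a] is a 2-cochain. This is the classical contraction by the Euler
    field, from 2-cochains to 1-cochains; dividing by [d + 2] normalizes it on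
    1-cochains evaluated in degree [d + 1]. *)
Definition koszul_homotopy (C : Vd -> Vd -> A -> W) v a : W :=
  \sum_i C v (x_ i) (cp_rescale 2 (cp_deriv i a)).

(** The Euler identity turns [h d + d h] into the identity: the last sum is
    the coboundary of the contraction of [F]. *)
Lemma koszul_homotopyK (F : Vd -> A -> W) v a :
  (forall v, linear (F v)) -> (forall a, linear (F^~ a)) ->
  koszul_homotopy (fun v w q => F v (w .* q) - F w (v .* q)) v a
    = F v a - \sum_i F (x_ i) (cp_rescale 1 (cp_deriv i (v .* a))).
Proof.
move=> Fr Fl; rewrite /koszul_homotopy sumrB.
rewrite -(linear_sum_prop (Fr v)).
rewrite -[X in _ = F v X - _](@cp_euler _ _ _ rG 1) //.
rewrite scale1r (linearD_prop (Fr v)) -addrA; congr (_ + _).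
have E i : F (x_ i) (cp_rescale 1 (cp_deriv i (v .* a)))
   = F (x_ i) (v .* cp_rescale 2 (cp_deriv i a))
     + v 0 i *: F (x_ i) (cp_rescale 1 a).
  rewrite cp_deriv_lin (linearD_prop (@cp_rescale_linear _ _ _ rG 1)).
  rewrite cp_rescale_lin (linearD_prop (Fr _)).
  rewrite (linearZ_prop (@cp_rescale_linear _ _ _ rG 1)).
  by rewrite (linearZ_prop (Fr _)).
under [in RHS]eq_bigr => i _ do rewrite E.
rewrite big_split /= -(sum_delta v (Fl (cp_rescale 1 a))).
by rewrite opprD addrCA subrr addr0.
Qed.

(** A 1-cochain whose own contraction vanishes is determined by its
    coboundary. *)
Lemma koszul_homotopy_unique (F : Vd -> A -> W) v a :
  (forall v, linear (F v)) -> (forall a, linear (F^~ a)) ->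
  (forall b, \sum_i F (x_ i) (cp_rescale 1 (cp_deriv i b)) = 0) ->
  F v a = koszul_homotopy (fun v w q => F v (w .* q) - F w (v .* q)) v a.
Proof.
by move=> Fr Fl F0; rewrite (koszul_homotopyK v a Fr Fl) (F0 (v .* a)) subr0.
Qed.

(** The Koszul complex is exact in degree 2, with an explicit primitive. The
    cocycle condition is only required at the elements of degree below that of
    [p] which occur, as it is available there only in an induction on the
    degree. *)
Lemma koszul_exact (C : Vd -> Vd -> A -> W) v w p :
  (forall w q, linear (fun v => C v w q)) ->
  (forall v w, linear (C v w)) ->
  (forall v w q, C v w q = - C w v q) ->
  (forall i, let q := cp_rescale 3 (cp_deriv i p) in
     C v (x_ i) (w .* q) + C (x_ i) w (v .* q) + C w v (x_ i .* q) = 0) ->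
  koszul_homotopy C v (w .* p) - koszul_homotopy C w (v .* p) = C v w p.
Proof.
move=> Cl Cq Calt Ccyc; have Cr u q : linear (fun w => C u w q).
  by move=> c x y; rewrite !(Calt u) Cl opprD scalerN.
have E u u' : koszul_homotopy C u (u' .* p)
   = \sum_i C u (x_ i) (u' .* cp_rescale 3 (cp_deriv i p))
     + C u u' (cp_rescale 2 p).
  rewrite (sum_delta u' (Cr u (cp_rescale 2 p))) -big_split.
  apply: eq_bigr => i _ /=.
  rewrite cp_deriv_lin (linearD_prop (@cp_rescale_linear _ _ _ rG 2)).
  rewrite cp_rescale_lin (linearD_prop (Cq _ _)).
  rewrite (linearZ_prop (@cp_rescale_linear _ _ _ rG 2)).
  by rewrite (linearZ_prop (Cq _ _)).
rewrite !E opprD addrACA -sumrB (Calt w v (cp_rescale 2 p)) opprK.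
rewrite -[X in _ = C v w X](@cp_euler _ _ _ rG 2 p) // (linearD_prop (Cq _ _)).
rewrite (linear_sum_prop (Cq _ _)) (linearZ_prop (Cq _ _)).
congr (_ + _); last by rewrite scaler_nat mulr2n.
apply: eq_bigr => i _; rewrite (Calt w) opprK.
by move/eqP: (Ccyc i); rewrite addr_eq0 -Calt => /eqP.
Qed.

End KoszulContraction.

(** * Left multiplications of the deformed algebra *)

(* Identities between sums are checked on the coefficient of every monomial. *)
Ltac abelian_group :=
  apply/ffunP => ?; rewrite !ffunE; apply/mpolyP => ?;
  rewrite ?(mcoeffD, mcoeffN, mcoeff0); ring.

Section LeftMultiplication.
Variables (R : numFieldType) (gT : finGroupType) (n : nat).
Variable rG : mx_representation R [set: gT] n.
Local Notation A := (crossed_product rG).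
Local Notation Vd := 'rV[R]_n.
Local Notation "v .* a" := (cp_lin rG v * (a : A)) (at level 40).
Local Notation "g ** v" := (dual_act rG g v) (at level 30).
Local Notation gr := (cp_group rG).
Local Notation x_ i := (delta_mx 0 i : Vd).
Variable pi : gT -> Vd -> Vd -> Vd.
Implicit Types (E : Vd -> A -> A) (v w : Vd) (a b q : A) (g h : gT).

Definition perturb E v a : A := v .* a + E v a.

(** The value that the relation [x y - y x = \sum_g pi_g(x, y) g] prescribes
    for the commutator of the left multiplications by [v] and [w]. *)
Definition commutator E v w a : A := \sum_g perturb E (pi g v w) (gr g * a).

(** For left multiplications [a |-> v a + E v a], the relation for the
    commutator says that the Koszul coboundary [E v (w a) - E w (v a)] is
    [defect E v w a]. The latter only involves [E] in degrees up to that of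
    [a], one less than on the left: this is what makes a recursion on the
    degree possible. *)
Definition defect E v w a : A :=
  commutator E v w a - perturb E v (E w a) + perturb E w (E v a).

Definition next_correction E : Vd -> A -> A := koszul_homotopy (defect E).

Definition correction_seq k : Vd -> A -> A :=
  iter k next_correction (fun _ _ => 0).

Definition correction v : A -> A := cp_limit (fun k => correction_seq k v).

Hypothesis pi_linl : forall g w, linear (pi g ^~ w).
Hypothesis pi_linr : forall g v, linear (pi g v).
Hypothesis pi_alt : forall g v, pi g v v = 0.
Hypothesis pi_inv : forall h g v w,
  pi (h * g * h^-1)%g (h ** v) (h ** w) = h ** (pi g v w).

(** The properties of corrections that the contraction preserves. The last two
    say that left multiplications commute with right multiplication by the
    group and are equivariant. *)
Record admissible E : Prop := {
  adm_linr : forall v, linear (E v);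
  adm_linl : forall a, linear (E^~ a);
  adm_deg : forall k v a, cp_deg_lt k a -> cp_deg_lt k (E v a);
  adm_mul_group : forall v a g, E v (a * gr g) = E v a * gr g;
  adm_group : forall g v a, gr g * E v a = E (g ** v) (gr g * a)
}.

Lemma dual_act_linear g : linear (dual_act rG g).
Proof. by move=> c v w; rewrite /dual_act mulmxDl scalemxAl. Qed.

Lemma pi_skew g v w : pi g v w = - pi g w v.
Proof.
have := pi_alt g (v + w); rewrite (linearD_prop (pi_linr g _)).
rewrite !(linearD_prop (pi_linl g _)) !pi_alt add0r addr0 => /eqP.
by rewrite addrC addr_eq0 => /eqP.
Qed.

Section Admissible.
Variable E : Vd -> A -> A.
Hypothesis EA : admissible E.
Let Er := adm_linr EA.
Let El := adm_linl EA.

Lemma perturb_linr v : linear (perturb E v).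
Proof. by apply: linear_add; [apply: mulr_linear|apply: Er]. Qed.

Lemma perturb_linl a : linear (perturb E ^~ a).
Proof.
apply: linear_add; last exact: El.
exact: (linear_comp (mull_linear a) (@cp_lin_linear _ _ _ rG)).
Qed.

Lemma perturb_deg k v a : cp_deg_lt k a -> cp_deg_lt k.+1 (perturb E v a).
Proof.
move=> ak; apply: cp_deg_ltD; first exact: cp_deg_lt_lin.
exact: cp_deg_ltW (leqnSn k) (adm_deg EA v ak).
Qed.

Lemma perturb_mul_group v a g : perturb E v (a * gr g) = perturb E v a * gr g.
Proof. by rewrite /perturb (adm_mul_group EA) mulrDl -!mulrA. Qed.

Lemma perturb_group g v a :
  gr g * perturb E v a = perturb E (g ** v) (gr g * a).
Proof. by rewrite /perturb mulrDr (adm_group EA) cp_groupC. Qed.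

Lemma commutator_linr v w : linear (commutator E v w).
Proof.
apply: linear_bigsum => g.
by apply: linear_comp; [apply: perturb_linr|apply: mulr_linear].
Qed.

Lemma commutator_linl w a : linear (fun v => commutator E v w a).
Proof.
apply: linear_bigsum => g.
by apply: (linear_comp (perturb_linl _)); apply: pi_linl.
Qed.

Lemma commutator_skew v w a : commutator E v w a = - commutator E w v a.
Proof.
rewrite /commutator -sumrN; apply: eq_bigr => g _.
by rewrite pi_skew (linearN_prop (perturb_linl _)).
Qed.

Lemma commutator_deg k v w a :
  cp_deg_lt k a -> cp_deg_lt k.+1 (commutator E v w a).
Proof.
move=> ak; apply: cp_deg_lt_sum => g.
exact/perturb_deg/cp_deg_lt_group.
Qed.

Lemma commutator_mul_group v w a g :
  commutator E v w (a * gr g) = commutator E v w a * gr g.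
Proof.
rewrite /commutator mulr_suml; apply: eq_bigr => h _.
by rewrite mulrA perturb_mul_group.
Qed.

Lemma commutator_group g v w a :
  gr g * commutator E v w a = commutator E (g ** v) (g ** w) (gr g * a).
Proof.
rewrite /commutator mulr_sumr [RHS](reindex_inj (conjg_inj g^-1%g)) /=.
apply: eq_bigr => h _; rewrite perturb_group conjgE invgK mulgA pi_inv.
by rewrite !mulrA !cp_groupM mulgKV.
Qed.

Lemma defect_linr v w : linear (defect E v w).
Proof.
apply: linear_add; last by apply: linear_comp; [apply: perturb_linr|apply: Er].
apply: linear_sub; first exact: commutator_linr.
by apply: linear_comp; [apply: perturb_linr|apply: Er].
Qed.

Lemma defect_linl w a : linear (fun v => defect E v w a).
Proof.
apply: linear_add; last by apply: linear_comp; [apply: perturb_linr|apply: El].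
by apply: linear_sub; [apply: commutator_linl|apply: perturb_linl].
Qed.

Lemma defect_skew v w a : defect E v w a = - defect E w v a.
Proof.
rewrite /defect commutator_skew [RHS]opprD [X in _ = X + _]opprD opprK.
by rewrite addrAC.
Qed.

Lemma defect_deg k v w a : cp_deg_lt k a -> cp_deg_lt k.+1 (defect E v w a).
Proof.
move=> ak; apply: cp_deg_ltD; last exact/perturb_deg/(adm_deg EA).
by apply: cp_deg_ltB; [apply: commutator_deg|apply/perturb_deg/(adm_deg EA)].
Qed.

Lemma next_correction_admissible : admissible (next_correction E).
Proof.
split.
- move=> v; apply: linear_bigsum => i; apply: linear_comp.
    exact: defect_linr.
  by apply: linear_comp; [apply: cp_rescale_linear|apply: cp_deriv_linear].
- by move=> a; apply: linear_bigsum => i; apply: defect_linl.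
- case=> [|k] v a ak.
    rewrite (cp_deg_lt0 ak) /next_correction /koszul_homotopy big1.
      exact: cp_deg_lt_0.
    move=> i _; rewrite (linear0_prop (cp_deriv_linear _)).
    rewrite (linear0_prop (cp_rescale_linear _)).
    exact: (linear0_prop (defect_linr _ _)).
  apply: cp_deg_lt_sum => i; apply: defect_deg.
  exact/cp_deg_lt_rescale/cp_deg_lt_deriv.
- move=> v a g; rewrite /next_correction /koszul_homotopy mulr_suml.
  apply: eq_bigr => i _; rewrite /cp_deriv /cp_rescale !cp_map_mul_group.
  rewrite /defect commutator_mul_group !(adm_mul_group EA) !perturb_mul_group.
  by rewrite [RHS]mulrDl [X in _ = X + _]mulrBl.
- move=> g v a; rewrite /next_correction /koszul_homotopy mulr_sumr.
  pose B w b := defect E (g ** v) w (cp_rescale 2 b).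
  rewrite -(@sum_deriv_group _ _ _ rG A B).
  + apply: eq_bigr => i _; rewrite /B cp_rescale_group /defect mulrDr mulrBr.
    by rewrite commutator_group !perturb_group !(adm_group EA).
  + move=> b; rewrite /B => c x y; rewrite !(defect_skew (g ** v)).
    by rewrite defect_linl opprD scalerN.
  + move=> w; apply: linear_comp; first exact: defect_linr.
    exact: cp_rescale_linear.
Qed.

End Admissible.

Lemma correction_seq_admissible k : admissible (correction_seq k).
Proof.
elim: k => [|k IHk]; last exact: next_correction_admissible.
split=> //.
- by move=> v c x y; rewrite scaler0 addr0.
- by move=> a c x y; rewrite scaler0 addr0.
- by move=> k v a _; apply: cp_deg_lt_0.
- by move=> *; rewrite mul0r.
- by move=> *; rewrite mulr0.
Qed.

(** The contraction differentiates, so its values in degree [k] only depend on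
    [E] in degrees less than [k]. *)
Lemma next_correction_local E E' k : admissible E -> admissible E' ->
  (forall v a, cp_deg_lt k a -> E v a = E' v a) ->
  forall v a, cp_deg_lt k.+1 a ->
    next_correction E v a = next_correction E' v a.
Proof.
move=> EA EA' EE v a ak; apply: eq_bigr => i _.
have qk : cp_deg_lt k (cp_rescale 2 (cp_deriv i a)).
  exact/cp_deg_lt_rescale/cp_deg_lt_deriv.
rewrite /defect /commutator /perturb !EE //; try exact: adm_deg.
congr (_ - _ + _); apply: eq_bigr => g _; rewrite EE //.
exact: cp_deg_lt_group.
Qed.

Lemma correction_seq_stable k v a :
  cp_deg_lt k a -> correction_seq k.+1 v a = correction_seq k v a.
Proof.
elim: k v a => [|k IHk] v a ak.
  rewrite (cp_deg_lt0 ak) !linear0_prop //; apply: adm_linr;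
  exact: correction_seq_admissible.
by apply: next_correction_local IHk _ _ ak; apply: correction_seq_admissible.
Qed.

Lemma correctionE k v a :
  cp_deg_lt k a -> correction v a = correction_seq k v a.
Proof.
by apply: cp_limitE => // l b; apply: correction_seq_stable.
Qed.

Lemma correction_admissible : admissible correction.
Proof.
split.
- move=> v; apply: cp_limit_linear => [k|k a].
    exact/adm_linr/correction_seq_admissible.
  exact: correction_seq_stable.
- move=> a c v w; have [k ak] := cp_deg_lt_bound a.
  rewrite !(correctionE _ ak); apply: adm_linl.
  exact: correction_seq_admissible.
- move=> k v a ak; rewrite (correctionE v ak).
  exact: adm_deg (correction_seq_admissible k) _ _ _ ak.
- move=> v a g; have [k ak] := cp_deg_lt_bound a.
  rewrite (correctionE v ak) (correctionE v (cp_deg_lt_mul_group g ak)).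
  exact: adm_mul_group (correction_seq_admissible k) _ _ _.
- move=> g v a; have [k ak] := cp_deg_lt_bound a.
  rewrite (correctionE v ak) (correctionE _ (cp_deg_lt_group g ak)).
  exact: adm_group (correction_seq_admissible k) _ _ _.
Qed.

Lemma correction_fix v a :
  correction v a = koszul_homotopy (defect correction) v a.
Proof.
have [k ak] := cp_deg_lt_bound a.
have ak1 := cp_deg_ltW (leqnSn k) ak; rewrite (correctionE v ak1).
apply: next_correction_local ak1; first exact: correction_seq_admissible.
  exact: correction_admissible.
by move=> w b bk; rewrite (correctionE w bk).
Qed.

Hypothesis pi_shift : forall B : Vd -> Vd -> A,
  (forall w, linear (B^~ w)) -> (forall v, linear (B v)) ->
  forall g u v w, B (pi g v w) (g ** u - u) + B (pi g w u) (g ** v - v)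
                    + B (pi g u v) (g ** w - w) = 0.
Hypothesis pi_jacobi : forall g u v w,
  \sum_(ab : gT * gT | (ab.1 * ab.2)%g == g)
    (pi ab.1 (pi ab.2 v w) u + pi ab.1 (pi ab.2 w u) v
       + pi ab.1 (pi ab.2 u v) w) = 0.

Definition left_mult : Vd -> A -> A := perturb correction.
Local Notation X := left_mult.
Local Notation E := correction.
Local Notation K := (commutator correction).
Local Notation EA := correction_admissible.

#[local] Opaque correction.

Lemma left_mult_linr v : linear (X v).
Proof. exact: perturb_linr EA v. Qed.

Lemma left_mult_linl a : linear (X ^~ a).
Proof. exact: perturb_linl EA a. Qed.

Lemma left_mult_deg k v a : cp_deg_lt k a -> cp_deg_lt k.+1 (X v a).
Proof. exact: perturb_deg EA k v a. Qed.

Lemma left_mult_mul_group v a g : X v (a * gr g) = X v a * gr g.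
Proof. exact: perturb_mul_group EA v a g. Qed.

Lemma left_mult_group g v a : gr g * X v a = X (g ** v) (gr g * a).
Proof. exact: perturb_group EA g v a. Qed.

Lemma left_mult_comm_def v w a :
  X v (X w a) - X w (X v a) - K v w a
    = E v (w .* a) - E w (v .* a) - defect E v w a.
Proof.
have XD u b : X u b = u .* b + E u b by [].
have EX u u' : X u (X u' a) = u .* (u' .* a) + E u (u' .* a) + X u (E u' a).
  by rewrite [X u' a]XD (linearD_prop (left_mult_linr _)) XD.
rewrite !EX cp_linC /defect -!/(X _ _).
move: (w .* (v .* a)) (E v _) (E w _) (X v _) (X w _) (K v w a).
move=> b1 b2 b3 b4 b5 b6; abelian_group.
Qed.

(** By the commutation relation at [E u q], the defect is expressed through
    [X] alone, up to two terms that cancel in the cyclic sum over [u], [v] and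
    [w]. *)
Lemma defect_lin v w u q :
  K v w (E u q) = X v (X w (E u q)) - X w (X v (E u q)) ->
  defect E v w (u .* q)
    = K v w (X u q) - X v (X w (X u q)) + X w (X v (X u q))
      + X v (w .* (u .* q)) - X w (v .* (u .* q)).
Proof.
move=> KE; have XD u' b : X u' b = u' .* b + E u' b by [].
have EX u1 u2 : X u1 (X u2 (X u q)) = X u1 (u2 .* (u .* q))
    + X u1 (E u2 (u .* q)) + X u1 (X u2 (E u q)).
  rewrite [X u q]XD (linearD_prop (left_mult_linr u2)) [X u2 (u .* q)]XD.
  by rewrite !(linearD_prop (left_mult_linr u1)).
rewrite /defect -!/(X _ _).
rewrite (EX v w) (EX w v).
rewrite [X u q]XD.
rewrite (linearD_prop (commutator_linr EA v w)) KE.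
move: (X v (w .* (u .* q))) (X w (v .* (u .* q))).
move: (X v (E w (u .* q))) (X w (E v (u .* q))).
move: (X v (X w (E u q))) (X w (X v (E u q))) (K v w (u .* q)).
move=> b1 b2 b3 b4 b5 b6 b7; abelian_group.
Qed.

Definition commutes_below k := forall v w a, cp_deg_lt k a ->
  X v (X w a) - X w (X v a) = K v w a.

(** The Jacobi identity for the prescribed commutators. Moving [u] across a
    group element [g] replaces it by [g u = u + (g u - u)]: the contributions
    of [g u - u] cancel by [pi_shift], and the remaining ones, after one more
    use of the commutation relation in lower degree, by [pi_jacobi]. *)
Lemma commutator_jacobi k v w u q : commutes_below k -> cp_deg_lt k q ->
  (K v w (X u q) - X u (K v w q)) + (K w u (X v q) - X v (K w u q))
    + (K u v (X w q) - X w (K u v q)) = 0.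
Proof.
move=> comm qk.
pose B g x y := X x (X y (gr g * q)).
have split_comm x y z : K x y (X z q) - X z (K x y q)
    = \sum_g B g (pi g x y) (g ** z - z)
      + \sum_g \sum_h X (pi h (pi g x y) z) (gr (h * g)%g * q).
  rewrite /commutator -!/(X _ _) (linear_sum_prop (left_mult_linr _)) -sumrB.
  rewrite -big_split; apply: eq_bigr => g _ /=.
  rewrite left_mult_group /B (linearB_prop (left_mult_linl _)).
  rewrite (linearB_prop (left_mult_linr _)) -!/(X _ _).
  have := comm (pi g x y) z _ (cp_deg_lt_group g qk).
  have -> : K (pi g x y) z (gr g * q)
      = \sum_h X (pi h (pi g x y) z) (gr (h * g)%g * q).
    by apply: eq_bigr => h _; rewrite mulrA cp_groupM.
  by move=> <-; rewrite addrA subrK.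
apply: (etrans (congr2 +%R (congr2 +%R (split_comm v w u) (split_comm w u v))
                          (split_comm u v w))).
rewrite [X in X + _]addrACA [LHS]addrACA [X in X + _](_ : _ = 0).
  rewrite add0r -!big_split /=; under eq_bigr => g _ do rewrite -!big_split /=.
  rewrite exchange_big pair_big_dep /=.
  rewrite (partition_big (fun ab : gT * gT => (ab.1 * ab.2)%g) predT) //=.
  rewrite big1 // => k' _.
  transitivity (X (\sum_(ab : gT * gT | (ab.1 * ab.2)%g == k')
      (pi ab.1 (pi ab.2 v w) u + pi ab.1 (pi ab.2 w u) v
         + pi ab.1 (pi ab.2 u v) w)) (gr k' * q)); last first.
    by rewrite pi_jacobi (linear0_prop (left_mult_linl _)).
  rewrite (linear_sum_prop (left_mult_linl _)); apply: eq_bigr => ab /eqP ->.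
  by rewrite !(linearD_prop (left_mult_linl _)).
rewrite -!big_split big1 // => g _ /=.
apply: pi_shift => [y|x]; first exact: left_mult_linl.
by apply: linear_comp; [apply: left_mult_linr|apply: left_mult_linl].
Qed.

Lemma defect_cocycle k v w u q : commutes_below k -> cp_deg_lt k q ->
  defect E v w (u .* q) + defect E w u (v .* q) + defect E u v (w .* q) = 0.
Proof.
move=> comm qk.
rewrite !defect_lin; try by rewrite comm //; apply: adm_deg EA _ _ _ qk.
have J := commutator_jacobi v w u comm qk; rewrite -[RHS]J.
rewrite -!(comm _ _ _ qk) !(linearB_prop (left_mult_linr _)).
rewrite (cp_linC w u) (cp_linC u v) (cp_linC v w).
move: (X u (w .* (v .* q))) (X v (u .* (w .* q))) (X w (v .* (u .* q))).
move: (K v w (X u q)) (K w u (X v q)) (K u v (X w q)) => b1 b2 b3 b4 b5 b6.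
move: (X v (X w (X u q))) (X w (X v (X u q))) (X w (X u (X v q))).
move: (X u (X w (X v q))) (X u (X v (X w q))) (X v (X u (X w q))).
move=> b7 b8 b9 b10 b11 b12; abelian_group.
Qed.

(** This is the theorem of Poincare, Birkhoff and Witt: the left
    multiplications satisfy the defining relations, and their leading terms
    are the commutative ones. By induction on the degree the defect is a
    Koszul cocycle, hence the coboundary of its contraction. *)
Lemma left_mult_commutator v w a : X v (X w a) - X w (X v a) = K v w a.
Proof.
have [k ak] := cp_deg_lt_bound a; suff comm : commutes_below k by apply: comm.
elim: k {v w a ak} => [|k IHk] v w a ak.
  rewrite (cp_deg_lt0 ak) !(linear0_prop (left_mult_linr _)) subrr.
  by rewrite (linear0_prop (commutator_linr EA _ _)).
apply/eqP; rewrite -subr_eq0 left_mult_comm_def !correction_fix subr_eq0.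
apply/eqP; apply: koszul_exact => [u q|u u'|u u' q|i].
- exact: (defect_linl EA).
- exact: (defect_linr EA).
- exact: (defect_skew EA).
apply: defect_cocycle IHk _.
exact/cp_deg_lt_rescale/cp_deg_lt_deriv.
Qed.

(** * The filtered product *)

Fixpoint prod_seq k a b : A :=
  if k is l.+1 then
    cp_homog 0 a * b
      + \sum_i X (x_ i) (prod_seq l (cp_rescale 1 (cp_deriv i a)) b)
  else 0.

(** The recursion is the Euler identity for [a], with the multiplication by
    [x_i] deformed. It amounts to symmetric ordering: a power of a linear form
    acts as the power of the deformed left multiplication by this form. Unlike
    an ordering of the coordinates, it is compatible with the group. *)
Definition filtered_prod a b : A := cp_limit (fun k a => prod_seq k a b) a.
Local Infix "<*>" := filtered_prod (at level 40, left associativity).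

Lemma prod_seq_linear k b : linear (prod_seq k ^~ b).
Proof.
elim: k => [|k IHk]; first by move=> c x y; rewrite scaler0 addr0.
apply: linear_add.
  exact: (linear_comp (mull_linear b) (@cp_homog_linear _ _ _ rG 0)).
apply: linear_bigsum => i; apply: linear_comp; first exact: left_mult_linr.
apply: (linear_comp IHk); apply: linear_comp; first exact: cp_rescale_linear.
exact: cp_deriv_linear.
Qed.

Lemma prod_seq_stable k a b :
  cp_deg_lt k a -> prod_seq k.+1 a b = prod_seq k a b.
Proof.
elim: k a => [|k IHk] a ak.
  by rewrite (cp_deg_lt0 ak) !(linear0_prop (prod_seq_linear _ b)).
congr (_ + _); apply: eq_bigr => i _; congr (X _ _).
exact/IHk/cp_deg_lt_rescale/cp_deg_lt_deriv.
Qed.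

Lemma filtered_prod_linl b : linear (filtered_prod ^~ b).
Proof.
apply: (@cp_limit_linear _ _ _ _ _ (fun k a => prod_seq k a b)) => [k|k a].
  exact: prod_seq_linear.
exact: prod_seq_stable.
Qed.

Lemma filtered_prodE k a b : cp_deg_lt k a -> a <*> b = prod_seq k a b.
Proof.
by apply: (@cp_limitE _ _ _ _ _ (fun k a => prod_seq k a b)) => l c;
  apply: prod_seq_stable.
Qed.

Lemma filtered_prod_fix a b : a <*> b = cp_homog 0 a * b
  + \sum_i X (x_ i) (cp_rescale 1 (cp_deriv i a) <*> b).
Proof.
have [k ak] := cp_deg_lt_bound a.
rewrite (filtered_prodE _ (cp_deg_ltW (leqnSn k) ak)).
congr (_ + _); apply: eq_bigr => i _; congr (X _ _).
apply/esym/filtered_prodE.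
exact/cp_deg_lt_rescale/cp_deg_lt_deriv/(cp_deg_ltW (leqnSn k)).
Qed.

#[local] Opaque filtered_prod.

Lemma deg_ind (P : A -> Prop) : P 0 ->
  (forall a, (forall i, P (cp_rescale 1 (cp_deriv i a))) -> P a) ->
  forall a, P a.
Proof.
move=> P0 Pder a; have [k] := cp_deg_lt_bound a.
elim: k a => [|k IHk] a ak; first by rewrite (cp_deg_lt0 ak).
by apply: Pder => i; apply/IHk/cp_deg_lt_rescale/cp_deg_lt_deriv.
Qed.

Lemma filtered_prod0 b : 0 <*> b = 0.
Proof. exact: linear0_prop (filtered_prod_linl b). Qed.

Lemma filtered_prod_linr a : linear (filtered_prod a).
Proof.
move: a; apply: deg_ind => [c x y|a IHa c x y].
  by rewrite !filtered_prod0 scaler0 addr0.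
rewrite !(filtered_prod_fix a); move: c x y; apply: linear_add.
  exact: mulr_linear.
by apply: linear_bigsum => i; apply: linear_comp; first exact: left_mult_linr.
Qed.

Lemma filtered_prod_mul_group a b g : a <*> (b * gr g) = (a <*> b) * gr g.
Proof.
move: a; apply: deg_ind => [|a IHa]; first by rewrite !filtered_prod0 mul0r.
rewrite !(filtered_prod_fix a) mulrDl mulr_suml mulrA; congr (_ + _).
by apply: eq_bigr => i _; rewrite IHa left_mult_mul_group.
Qed.

Lemma filtered_prod_mid_group a b g : (a * gr g) <*> b = a <*> (gr g * b).
Proof.
move: a; apply: deg_ind => [|a IHa]; first by rewrite mul0r !filtered_prod0.
rewrite !(filtered_prod_fix _ _) mulrA -cp_map_mul_group; congr (_ + _).
apply: eq_bigr => i _; rewrite -IHa; congr (X _ (_ <*> _)).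
by rewrite /cp_rescale /cp_deriv !cp_map_mul_group.
Qed.

Lemma filtered_prod_group a b g : gr g * (a <*> b) = (gr g * a) <*> b.
Proof.
move: a; apply: deg_ind => [|a IHa].
  by rewrite mulr0 !filtered_prod0 mulr0.
rewrite !(filtered_prod_fix _ _) mulrDr mulrA -cp_homog_group; congr (_ + _).
pose B v c := X v (cp_rescale 1 c <*> b).
apply: etrans (@sum_deriv_group _ _ _ rG A B g a _ _) => [|c|v].
- rewrite mulr_sumr; apply: eq_bigr => i _.
  by rewrite left_mult_group IHa /B cp_rescale_group.
- exact: left_mult_linl.
- apply: linear_comp; first exact: left_mult_linr.
  exact: (linear_comp (filtered_prod_linl b) (@cp_rescale_linear _ _ _ rG 1)).
Qed.

(** The failure [F v a] of this identity with [v a] in place of [X v a] is a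
    1-cochain; its contraction vanishes by definition of the product. By
    induction on the degree its coboundary is that of [E v a <*> b], so the
    two agree. *)
Lemma filtered_prod_left_mult v a b : X v (a <*> b) = X v a <*> b.
Proof.
have [k ak] := cp_deg_lt_bound a.
elim: k v a ak => [|k IHk] v a ak.
  rewrite (cp_deg_lt0 ak) (linear0_prop (left_mult_linr v)) filtered_prod0.
  by rewrite (linear0_prop (left_mult_linr v)).
pose F v a := X v (a <*> b) - (v .* a) <*> b.
have Fr w : linear (F w).
  apply: linear_sub.
    exact: (linear_comp (left_mult_linr w) (filtered_prod_linl b)).
  exact: (linear_comp (filtered_prod_linl b) (mulr_linear _)).
have Fl c : linear (F^~ c).
  apply: linear_sub; first exact: left_mult_linl.
  apply: (linear_comp (filtered_prod_linl b)).
  exact: (linear_comp (mull_linear c) (@cp_lin_linear _ _ _ rG)).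
have Feuler c : \sum_i F (x_ i) (cp_rescale 1 (cp_deriv i c)) = 0.
  rewrite /F sumrB -(linear_sum_prop (filtered_prod_linl b)).
  have -> : \sum_i x_ i .* cp_rescale 1 (cp_deriv i c) = c - cp_homog 0 c.
    by rewrite -[X in X - _](@cp_euler0 _ _ _ rG c) addrK.
  rewrite (linearB_prop (filtered_prod_linl b)) (filtered_prod_fix c).
  rewrite (filtered_prod_fix (cp_homog 0 c)).
  have H0 : cp_homog 0 (cp_homog 0 c) = cp_homog 0 c.
    by apply/ffunP => g; rewrite !ffunE pihomog_id.
  have D0 i : cp_deriv i (cp_homog 0 c) = 0.
    exact/cp_deg_lt0/cp_deg_lt_deriv/cp_homog_deg.
  rewrite H0 [X in _ - (_ - (_ + X))]big1 => [|i _].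
    by rewrite addr0 [_ * b + _]addrC addrK subrr.
  rewrite D0 (linear0_prop (@cp_rescale_linear _ _ _ rG 1)) filtered_prod0.
  exact: linear0_prop (left_mult_linr _).
suff FE : F v a = E v a <*> b.
  move/eqP: FE; rewrite /F subr_eq => /eqP ->.
  by rewrite -(linearD_prop (filtered_prod_linl b)) addrC.
rewrite (koszul_homotopy_unique v a Fr Fl Feuler) correction_fix.
rewrite (linear_sum_prop (filtered_prod_linl b)); apply: eq_bigr => i _.
set q := cp_rescale 2 _; have qk : cp_deg_lt k q.
  exact/cp_deg_lt_rescale/cp_deg_lt_deriv.
have FE u : F u q = E u q <*> b.
  rewrite /F IHk // -(linearB_prop (filtered_prod_linl b)); congr (_ <*> _).
  by rewrite addrAC subrr add0r.
have FF u u' : F u (u' .* q) = X u (X u' (q <*> b)) - X u (E u' q <*> b)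
    - (u .* (u' .* q)) <*> b.
  rewrite {1}/F -(linearB_prop (left_mult_linr u)); congr (X u _ - _).
  by rewrite -FE /F opprB addrCA subrr addr0.
rewrite !FF cp_linC /defect (linearD_prop (filtered_prod_linl b)).
rewrite (linearB_prop (filtered_prod_linl b)) -!/(X _ _).
rewrite -!IHk //; try exact: adm_deg EA _ _ _ qk.
have -> : K v (x_ i) q <*> b = K v (x_ i) (q <*> b).
  rewrite /commutator (linear_sum_prop (filtered_prod_linl b)).
  apply: eq_bigr => g _; rewrite filtered_prod_group -!/(X _ _) IHk //.
  exact: cp_deg_lt_group.
rewrite -left_mult_commutator.
move: ((v .* (x_ i .* q)) <*> b) (X v (X (x_ i) (q <*> b))) => b1 b2.
move: (X (x_ i) (X v (q <*> b))) (X v (E (x_ i) q <*> b)) => b3 b4.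
by move: (X (x_ i) (E v q <*> b)) => b5; abelian_group.
Qed.

Lemma cp_homog0E a : cp_homog 0 a = \sum_g (a g)@_0 *: gr g.
Proof.
apply/ffunP => g; rewrite sum_ffunE (bigD1 g) //= big1 => [|h /negPf hg].
  rewrite !ffunE eqxx addr0 alg_mpolyC.
  exact: pihomog0E.
by rewrite !ffunE eq_sym hg scaler0.
Qed.

Lemma filtered_prodA a b c : a <*> (b <*> c) = (a <*> b) <*> c.
Proof.
move: a; apply: deg_ind => [|a IHa]; first by rewrite !filtered_prod0.
rewrite !(filtered_prod_fix a) (linearD_prop (filtered_prod_linl c)).
congr (_ + _).
  rewrite cp_homog0E !mulr_suml (linear_sum_prop (filtered_prod_linl c)).
  apply: eq_bigr => g _; rewrite -!scalerAl.
  by rewrite (linearZ_prop (filtered_prod_linl c)) filtered_prod_group.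
rewrite (linear_sum_prop (filtered_prod_linl c)); apply: eq_bigr => i _.
by rewrite IHa filtered_prod_left_mult.
Qed.

Lemma cp_homog0_deg1 a : cp_deg_lt 1 a -> cp_homog 0 a = a.
Proof. by move/cp_homog_sum; rewrite big_ord1. Qed.

Lemma correction_deg1 v a : cp_deg_lt 1 a -> E v a = 0.
Proof.
move=> a1; rewrite correction_fix /koszul_homotopy big1 // => i _.
rewrite (cp_deg_lt0 (cp_deg_lt_deriv i a1)).
rewrite (linear0_prop (@cp_rescale_linear _ _ _ rG 2)).
exact: linear0_prop (defect_linr EA _ _).
Qed.

Lemma filtered_prod_deg1 a b : cp_deg_lt 1 a -> a <*> b = a * b.
Proof.
move=> a1; rewrite filtered_prod_fix cp_homog0_deg1 // big1 ?addr0 // => i _.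
rewrite (cp_deg_lt0 (cp_deg_lt_deriv i a1)).
rewrite (linear0_prop (@cp_rescale_linear _ _ _ rG 1)) filtered_prod0.
exact: linear0_prop (left_mult_linr _).
Qed.

Lemma cp_deg_lt_group1 g : cp_deg_lt 1 (gr g).
Proof.
by move=> h; rewrite ffunE; case: eqP; rewrite ?msize1 // mmeasure0.
Qed.

Lemma left_mult_gr v g : X v (gr g) = cp_lin rG v * gr g.
Proof.
rewrite /left_mult /perturb correction_deg1 ?addr0 //.
exact: cp_deg_lt_group1.
Qed.

Lemma filtered_prod_lin v b : cp_lin rG v <*> b = X v b.
Proof.
rewrite -[cp_lin rG v]mulr1 -(left_mult_gr v 1%g) -filtered_prod_left_mult.
by rewrite filtered_prod_deg1 ?mul1r //; apply: cp_deg_lt_group1.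
Qed.

(** Both sides are the commutator of left multiplications at [1]. *)
Lemma filtered_prod_lin_comm v w :
  cp_lin rG v <*> cp_lin rG w - cp_lin rG w <*> cp_lin rG v
    = \sum_g cp_lin rG (pi g v w) * gr g.
Proof.
rewrite !filtered_prod_lin -[cp_lin rG w]mulr1 -(left_mult_gr w 1%g).
rewrite -[cp_lin rG v]mulr1 -(left_mult_gr v 1%g) left_mult_commutator.
by apply: eq_bigr => g _; rewrite mulr1 -/(X _ _) left_mult_gr.
Qed.

Lemma filtered_prod_leading i j a b :
  cp_deg_lt i.+1 a -> cp_deg_lt j.+1 b -> cp_deg_lt (i + j) (a <*> b - a * b).
Proof.
move=> ai bj; elim: i a ai => [|i IHi] a ai.
  by rewrite filtered_prod_deg1 // subrr; apply: cp_deg_lt_0.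
rewrite filtered_prod_fix -[X in _ - X * b](@cp_euler0 _ _ _ rG a).
rewrite mulrDl addrC opprD addrA addrNK addrC mulr_suml -sumrB.
apply: cp_deg_lt_sum => l; set q := cp_rescale 1 _.
have qi : cp_deg_lt i.+1 q by apply/cp_deg_lt_rescale/cp_deg_lt_deriv.
have -> : X (x_ l) (q <*> b) - x_ l .* q * b
    = X (x_ l) (q <*> b - q * b) + E (x_ l) (q * b).
  rewrite (linearB_prop (left_mult_linr _)) -mulrA.
  by rewrite {3}/left_mult /perturb opprD addrA subrK.
rewrite addSn; apply: cp_deg_ltD.
  by apply: left_mult_deg; apply: IHi.
by apply: (adm_deg EA); apply: cp_deg_lt_mul.
Qed.

Lemma filtered_prod_deg i j a b :
  cp_deg_lt i.+1 a -> cp_deg_lt j.+1 b -> cp_deg_lt (i + j).+1 (a <*> b).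
Proof.
move=> ai bj; rewrite -[_ <*> _](subrK (a * b)); apply: cp_deg_ltD.
  exact: cp_deg_ltW (leqnSn _) (filtered_prod_leading ai bj).
exact: cp_deg_lt_mul.
Qed.

End LeftMultiplication.

(** * Star products from their coefficients *)

Lemma sum_ord_widen (W : zmodType) (p M : nat) (F : nat -> W) : (p <= M)%N ->
  (forall i, (p <= i < M)%N -> F i = 0) -> \sum_(i < M) F i = \sum_(i < p) F i.
Proof.
move=> pM F0; rewrite (big_ord_widen _ F pM) [RHS]big_mkcond /=.
apply: eq_bigr => i _; case: ltnP => // pi; apply: F0.
by rewrite pi /=.
Qed.

Section StarProductFromTerms.
Variables (R : fieldType) (A : algType R) (m : nat -> A -> A -> A).
Hypothesis m_bilinear : forall k, bilinear_op (m k).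
Hypothesis m_order0 : forall a b, m 0 a b = a * b.
Hypothesis m_assoc : forall r a b c,
  \sum_(q < r.+1) m (r - q) (m q a b) c = \sum_(q < r.+1) m (r - q) a (m q b c).
Implicit Types (s t u : nat -> A) (c : nat -> R).

Definition star_of s t : nat -> A := fun N =>
  \sum_(i < N.+1) \sum_(j < (N - i).+1) m (N - i - j) (s i) (t j).

(** Multiplication by [hbar], and its left inverse. *)
Definition ps_shift s : nat -> A := fun k => if k is l.+1 then s l else 0.
Definition ps_tail s : nat -> A := fun k => s k.+1.

Let ml k b : linear (m k ^~ b) := (m_bilinear k).1 b.
Let mr k a : linear (m k a) := (m_bilinear k).2 a.

Lemma ps_split s : s =1 ps_add (ps_const (s 0)) (ps_shift (ps_tail s)).
Proof. by case=> [|k]; rewrite /ps_add /ps_const /= ?addr0 ?add0r. Qed.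

Lemma eq_star_of s s' t t' : s =1 s' -> t =1 t' -> star_of s t =1 star_of s' t'.
Proof.
move=> ss' tt' N; apply: eq_bigr => i _; apply: eq_bigr => j _.
by rewrite ss' tt'.
Qed.

Lemma star_of_addl s s' t :
  star_of (ps_add s s') t =1 ps_add (star_of s t) (star_of s' t).
Proof.
move=> N; rewrite /ps_add /star_of -big_split; apply: eq_bigr => i _.
by rewrite -big_split; apply: eq_bigr => j _; rewrite (linearD_prop (ml _ _)).
Qed.

Lemma star_of_addr s t t' :
  star_of s (ps_add t t') =1 ps_add (star_of s t) (star_of s t').
Proof.
move=> N; rewrite /ps_add /star_of -big_split; apply: eq_bigr => i _.
by rewrite -big_split; apply: eq_bigr => j _; rewrite (linearD_prop (mr _ _)).
Qed.

Lemma star_of_shiftl s t : star_of (ps_shift s) t =1 ps_shift (star_of s t).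
Proof.
have Z N d : \sum_(j < d) m (N - j) 0 (t j) = 0.
  by rewrite big1 // => j _; rewrite (linear0_prop (ml _ _)).
case=> [|N]; rewrite /star_of big_ord_recl Z add0r; first by rewrite big_ord0.
by apply: eq_bigr => i _; rewrite lift0 subSS.
Qed.

Lemma star_of_shiftr s t : star_of s (ps_shift t) =1 ps_shift (star_of s t).
Proof.
have rec d x : \sum_(j < d.+1) m (d - j) x (ps_shift t j)
    = if d is e.+1 then \sum_(j < e.+1) m (e - j) x (t j) else 0.
  rewrite big_ord_recl (linear0_prop (mr _ _)) add0r.
  case: d => [|d]; first by rewrite big_ord0.
  by apply: eq_bigr => j _; rewrite lift0 subSS.
case=> [|N]; rewrite /star_of; under eq_bigr => i _ do rewrite rec.
  by rewrite big_ord1.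
rewrite big_ord_recr /= subnn addr0; apply: eq_bigr => i _ /=.
by rewrite subSn // -ltnS.
Qed.

Lemma star_of_constl a t N :
  star_of (ps_const a) t N = \sum_(j < N.+1) m (N - j) a (t j).
Proof.
rewrite /star_of big_ord_recl [X in _ + X]big1 ?addr0 => [|i _].
  by rewrite subn0.
by rewrite big1 // => j _; rewrite (linear0_prop (ml _ _)).
Qed.

Lemma star_of_constr s b N :
  star_of s (ps_const b) N = \sum_(i < N.+1) m (N - i) (s i) b.
Proof.
apply: eq_bigr => i _.
rewrite big_ord_recl [X in _ + X]big1 ?addr0 ?subn0 // => j _.
by rewrite (linear0_prop (mr _ _)).
Qed.

Lemma star_of_coef k a b : star_coef star_of k a b = m k a b.
Proof.
rewrite /star_coef star_of_constl big_ord_recl subn0.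
rewrite [X in _ + X]big1 ?addr0 // => j _.
by rewrite (linear0_prop (mr _ _)).
Qed.

(** Splitting off the constant terms of [s], [t] and [u] reduces the
    coefficient of [hbar^N] to lower ones, except for constant arguments,
    where it is [m_assoc]. *)
Lemma star_of_assoc s t u :
  star_of (star_of s t) u =1 star_of s (star_of t u).
Proof.
pose assoc_at k s t u :=
  star_of (star_of s t) u k = star_of s (star_of t u) k.
have shiftl k s' t' : star_of (ps_shift s') t' k = ps_shift (star_of s' t') k.
  exact: star_of_shiftl.
have shiftr k s' t' : star_of s' (ps_shift t') k = ps_shift (star_of s' t') k.
  exact: star_of_shiftr.
have shift_assoc k s' t' u' : (forall l, (l < k)%N -> assoc_at l s' t' u') ->
    ps_shift (star_of (star_of s' t') u') k
      = ps_shift (star_of s' (star_of t' u')) k.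
  by case: k => // k; apply.
move=> N; move: s t u; suff: forall s t u, assoc_at N s t u by [].
elim/ltn_ind: N => N IHN.
have step1 s t u : assoc_at N (ps_const (s 0)) t u -> assoc_at N s t u.
  rewrite /assoc_at => E.
  rewrite (eq_star_of (eq_star_of (ps_split s) (frefl t)) (frefl u)).
  rewrite (eq_star_of (star_of_addl _ _ _) (frefl u)) star_of_addl.
  rewrite (eq_star_of (ps_split s) (frefl _)) star_of_addl /ps_add E.
  congr (_ + _); rewrite (eq_star_of (star_of_shiftl _ _) (frefl u)) !shiftl.
  by apply: shift_assoc => k kN; apply: IHN.
have step2 s t u : assoc_at N s (ps_const (t 0)) u -> assoc_at N s t u.
  rewrite /assoc_at => E.
  rewrite (eq_star_of (eq_star_of (frefl s) (ps_split t)) (frefl u)).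
  rewrite (eq_star_of (star_of_addr _ _ _) (frefl u)) star_of_addl.
  rewrite [RHS](eq_star_of (frefl s) (eq_star_of (ps_split t) (frefl u))).
  rewrite (eq_star_of (frefl s) (star_of_addl _ _ _)) star_of_addr /ps_add E.
  congr (_ + _); rewrite (eq_star_of (star_of_shiftr _ _) (frefl u)) shiftl.
  rewrite (eq_star_of (frefl s) (star_of_shiftl _ _)) shiftr.
  by apply: shift_assoc => k kN; apply: IHN.
have step3 s t u : assoc_at N s t (ps_const (u 0)) -> assoc_at N s t u.
  rewrite /assoc_at => E.
  rewrite (eq_star_of (frefl _) (ps_split u)) star_of_addr.
  rewrite [RHS](eq_star_of (frefl s) (eq_star_of (frefl t) (ps_split u))).
  rewrite (eq_star_of (frefl s) (star_of_addr _ _ _)) star_of_addr /ps_add E.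
  congr (_ + _); rewrite shiftr.
  rewrite (eq_star_of (frefl s) (star_of_shiftr _ _)) shiftr.
  by apply: shift_assoc => k kN; apply: IHN.
move=> s t u; apply/step1/step2/step3.
rewrite /assoc_at star_of_constr star_of_constl.
under eq_bigr => q _ do rewrite -/(star_coef star_of q _ _) star_of_coef.
by rewrite m_assoc; apply: eq_bigr => q _;
  rewrite -/(star_coef star_of q _ _) star_of_coef.
Qed.

Lemma ps_scale_split c s :
  ps_scale c s =1 ps_add (fun k => c 0%N *: s k)
                    (ps_shift (ps_scale (fun k => c k.+1) s)).
Proof.
case=> [|N]; rewrite /ps_scale /ps_add big_ord_recl subn0 /=.
  by rewrite big_ord0.
by congr (_ + _); apply: eq_bigr => i _; rewrite lift0 subSS.
Qed.

Lemma star_of_scalel c s t :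
  star_of (ps_scale c s) t =1 ps_scale c (star_of s t).
Proof.
move=> N; elim: N c s t => [|N IHN] c s t.
all: rewrite (eq_star_of (ps_scale_split c s) (frefl t)) star_of_addl.
all: rewrite ps_scale_split /ps_add star_of_shiftl /= ?IHN; congr (_ + _).
all: rewrite /star_of scaler_sumr; apply: eq_bigr => i _.
all: rewrite scaler_sumr; apply: eq_bigr => j _.
all: by rewrite (linearZ_prop (ml _ _)).
Qed.

Lemma star_of_scaler c s t :
  star_of s (ps_scale c t) =1 ps_scale c (star_of s t).
Proof.
move=> N; elim: N c s t => [|N IHN] c s t.
all: rewrite (eq_star_of (frefl s) (ps_scale_split c t)) star_of_addr.
all: rewrite ps_scale_split /ps_add star_of_shiftr /= ?IHN; congr (_ + _).
all: rewrite /star_of scaler_sumr; apply: eq_bigr => i _.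
all: rewrite scaler_sumr; apply: eq_bigr => j _.
all: by rewrite (linearZ_prop (mr _ _)).
Qed.

Lemma star_of_star_product : star_product star_of.
Proof.
split=> [|s t u|a b]; last by rewrite star_of_coef.
  split=> c s t u N.
    by rewrite star_of_addl /ps_add star_of_scalel.
  by rewrite star_of_addr /ps_add star_of_scaler.
exact: star_of_assoc.
Qed.

End StarProductFromTerms.

Lemma star_coef1_cocycle (R : fieldType) (A : algType R)
    (m : nat -> A -> A -> A) :
  (forall k, bilinear_op (m k)) -> (forall a b, m 0 a b = a * b) ->
  (forall r a b c, \sum_(q < r.+1) m (r - q)%N (m q a b) c
                     = \sum_(q < r.+1) m (r - q)%N a (m q b c)) ->
  cocycle2 (m 1).
Proof.
move=> mB m0 mA; split=> // a b c; have := mA 1%N a b c.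
rewrite !big_ord_recl !big_ord0 !addr0 !lift0 /= !m0 => E.
apply/eqP; rewrite subr_eq addrAC subr_eq add0r addrC -E.
by rewrite addrC.
Qed.

(** * Restoring the parameter from the grading *)

Section GradedSum.
Variables (R : numFieldType) (gT : finGroupType) (n : nat).
Variable rG : mx_representation R [set: gT] n.
Local Notation A := (crossed_product rG).

Lemma linear_ext_homog (W : lmodType R) (f g : A -> W) :
  linear f -> linear g ->
  (forall d a, cp_homog d a = a -> f a = g a) -> f =1 g.
Proof.
move=> fL gL fg a; have [k ak] := cp_deg_lt_bound a.
rewrite (cp_homog_sum ak) (linear_sum_prop fL) (linear_sum_prop gL).
by apply: eq_bigr => d _; apply/fg/cp_homog_id.
Qed.

Section GradedMaps.
Variables (W : lmodType R) (f : nat -> A -> W).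
Hypothesis f_linear : forall d, linear (f d).

(** The linear map that restricts to [f d] on elements of degree [d]. *)
Definition graded_sum : A -> W :=
  cp_limit (fun k a => \sum_(d < k) f d (cp_homog d a)).

Lemma graded_sumE k a :
  cp_deg_lt k a -> graded_sum a = \sum_(d < k) f d (cp_homog d a).
Proof.
apply: cp_limitE => l b bl.
by rewrite big_ord_recr /= (cp_homog_eq0 (leqnn l)) // linear0_prop // addr0.
Qed.

Lemma graded_sum_linear : linear graded_sum.
Proof.
apply: cp_limit_linear => [k|k a ak].
  apply: linear_bigsum => d; apply: (linear_comp (f_linear d)).
  exact: cp_homog_linear.
by rewrite big_ord_recr /= (cp_homog_eq0 (leqnn k)) // linear0_prop // addr0.
Qed.

Lemma graded_sum_homog d a : cp_homog d a = a -> graded_sum a = f d a.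
Proof.
move=> ad; have ak : cp_deg_lt d.+1 a by rewrite -ad; apply: cp_homog_deg.
rewrite (graded_sumE ak) big_ord_recr /= ad big1 ?add0r // => e _.
by rewrite -ad cp_homog_homog gtn_eqF // linear0_prop.
Qed.

End GradedMaps.

Section Terms.
Variable P : A -> A -> A.
Hypothesis P_linl : forall b, linear (P ^~ b).
Hypothesis P_linr : forall a, linear (P a).
Hypothesis P_deg : forall i j a b,
  cp_deg_lt i.+1 a -> cp_deg_lt j.+1 b -> cp_deg_lt (i + j).+1 (P a b).

(** The component of degree [D - k]; the test matters since the subtraction is
    truncated. *)
Definition drop_part k D (x : A) : A :=
  if (k <= D)%N then cp_homog (D - k) x else 0.

(** Giving [hbar] the degree 1 makes the relations of the deformed algebra
    homogeneous, so the coefficient of [hbar^k] lowers the degree by [k]. *)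
Definition prod_term k a b : A :=
  graded_sum
    (fun d a => graded_sum (fun e b => drop_part k (d + e) (P a b)) b) a.

Lemma drop_part_linear k D : linear (drop_part k D).
Proof.
move=> c x y; rewrite /drop_part; case: ifP => _; last by rewrite scaler0 addr0.
exact: cp_homog_linear.
Qed.

Let inner_linr k d a :
  linear (graded_sum (fun e b => drop_part k (d + e) (P a b))).
Proof.
apply: graded_sum_linear => e.
exact: (linear_comp (drop_part_linear k _) (P_linr a)).
Qed.

Let inner_linl k d b :
  linear (fun a => graded_sum (fun e b => drop_part k (d + e) (P a b)) b).
Proof.
move=> c x y; have [l bl] := cp_deg_lt_bound b.
have fL a e : linear (fun b => drop_part k (d + e) (P a b)).
  exact: (linear_comp (drop_part_linear k _) (P_linr a)).
rewrite !(graded_sumE (fL _) bl); move: c x y; apply: linear_bigsum => e.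
exact: (linear_comp (drop_part_linear k _) (P_linl _)).
Qed.

Lemma prod_term_bilinear k : bilinear_op (prod_term k).
Proof.
split=> [b|a].
  by apply: graded_sum_linear => d; apply: inner_linl.
move=> c x y; have [l al] := cp_deg_lt_bound a.
rewrite /prod_term !(graded_sumE (fun d => inner_linl k d _) al).
by move: c x y; apply: linear_bigsum => d; apply: inner_linr.
Qed.

Lemma prod_term_homog k d e a b : cp_homog d a = a -> cp_homog e b = b ->
  prod_term k a b = drop_part k (d + e) (P a b).
Proof.
move=> ad be; rewrite /prod_term.
rewrite (graded_sum_homog (fun d => inner_linl k d b) ad).
apply: graded_sum_homog be => e'.
exact: (linear_comp (drop_part_linear k _) (P_linr a)).
Qed.

Lemma drop_part_homog k D x :
  cp_homog (D - k) (drop_part k D x) = drop_part k D x.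
Proof.
rewrite /drop_part; case: ifP => _; first exact: cp_homog_id.
exact: (linear0_prop (@cp_homog_linear _ _ _ rG _)).
Qed.

Let homog_deg d (a : A) : cp_homog d a = a -> cp_deg_lt d.+1 a.
Proof. by move=> <-; apply: cp_homog_deg. Qed.

Lemma prod_term0 : (forall i j a b, cp_deg_lt i.+1 a -> cp_deg_lt j.+1 b ->
    cp_deg_lt (i + j) (P a b - a * b)) ->
  forall a b, prod_term 0 a b = a * b.
Proof.
move=> Plead a b; move: a; apply: linear_ext_homog; first 1 last.
- exact: mull_linear.
- move=> d a ad; move: b; apply: linear_ext_homog; first 1 last.
  + exact: mulr_linear.
  + move=> e b be; rewrite (prod_term_homog _ ad be) /drop_part subn0.
    rewrite -[P a b](subrK (a * b)).
    rewrite (linearD_prop (@cp_homog_linear _ _ _ rG _)).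
    rewrite (cp_homog_eq0 (leqnn _)) ?add0r ?cp_homog_mul //.
    exact: Plead (homog_deg ad) (homog_deg be).
  + exact: (prod_term_bilinear 0).2.
exact: (prod_term_bilinear 0).1.
Qed.

(** Summing over [q] restores all components of [x] of degree at least [D - r];
    the others cannot reach the degree [D + f - r]. *)
Lemma sum_drop_part (L : A -> A) f D r x :
  linear L ->
  (forall i y, cp_homog i y = y -> cp_deg_lt (i + f).+1 (L y)) ->
  cp_deg_lt D.+1 x ->
  \sum_(q < r.+1) drop_part (r - q) (D - q + f) (L (drop_part q D x))
    = drop_part r (D + f) (L x).
Proof.
move=> LL Ldeg xD.
pose t q :=
  if (q <= D)%N then drop_part r (D + f) (L (cp_homog (D - q) x)) else 0.
have -> : drop_part r (D + f) (L x) = \sum_(q < D.+1) t q.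
  rewrite {1}(cp_homog_sum xD) (linear_sum_prop LL).
  rewrite (linear_sum_prop (drop_part_linear r _)) (reindex_inj rev_ord_inj) /=.
  by apply: eq_bigr => q _; rewrite subSS /t -ltnS ltn_ord.
have t0 q : (r < q)%N -> t q = 0.
  move=> rq; rewrite /t; case: leqP => // qD; rewrite /drop_part.
  case: leqP => // rDf.
  apply: cp_homog_eq0 (Ldeg _ _ (cp_homog_id _ _)).
  by lia.
transitivity (\sum_(q < r.+1) t q).
  apply: eq_bigr => q _; rewrite /t {2}/drop_part; case: leqP => qD; last first.
    by rewrite (linear0_prop LL) (linear0_prop (drop_part_linear _ _)).
  rewrite /drop_part.
  have qr : (q <= r)%N by rewrite -ltnS.
  have -> : (r - q <= D - q + f)%N = (r <= D + f)%N by lia.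
  by have -> : (D - q + f - (r - q) = D + f - r)%N by lia.
have [le|lt] := leqP r.+1 D.+1.
  apply/esym/sum_ord_widen => // q /andP[rq _]; exact: t0.
apply: sum_ord_widen => [|q /andP[Dq _]]; first exact: ltnW.
by rewrite /t leqNgt Dq.
Qed.

(** On homogeneous elements both sides are one component of the product of the
    three. *)
Lemma prod_term_assoc : (forall a b c, P a (P b c) = P (P a b) c) ->
  forall r a b c,
    \sum_(q < r.+1) prod_term (r - q) (prod_term q a b) c
      = \sum_(q < r.+1) prod_term (r - q) a (prod_term q b c).
Proof.
move=> PA r a b c.
have tl k b' := (prod_term_bilinear k).1 b'.
have tr k a' := (prod_term_bilinear k).2 a'.
move: a; apply: linear_ext_homog.
- apply: linear_bigsum => q; exact: (linear_comp (tl _ _) (tl _ _)).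
- by apply: linear_bigsum => q; apply: tl.
move=> d a ad; move: b; apply: linear_ext_homog.
- apply: linear_bigsum => q; exact: (linear_comp (tl _ _) (tr _ _)).
- apply: linear_bigsum => q; exact: (linear_comp (tr _ _) (tl _ _)).
move=> e b be; move: c; apply: linear_ext_homog.
- by apply: linear_bigsum => q; apply: tr.
- apply: linear_bigsum => q; exact: (linear_comp (tr _ _) (tr _ _)).
move=> f c cf.
transitivity (drop_part r (d + e + f) (P (P a b) c)).
  rewrite -(@sum_drop_part (P ^~ c) f (d + e) r (P a b) (P_linl c)).
  - apply: eq_bigr => q _; rewrite (prod_term_homog q ad be).
    by rewrite (prod_term_homog _ (drop_part_homog _ _ _) cf).
  - by move=> i y yi; apply: P_deg; [apply: homog_deg|apply: homog_deg].
  - by apply: P_deg; apply: homog_deg.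
have -> : (d + e + f = e + f + d)%N by rewrite addnC addnA addnC addnA.
rewrite -PA -(@sum_drop_part (P a) d (e + f) r (P b c) (P_linr a)).
- apply: eq_bigr => q _; rewrite (prod_term_homog q be cf).
  by rewrite (prod_term_homog _ ad (drop_part_homog _ _ _)) addnC.
- by move=> i y yi; rewrite addnC; apply: P_deg; apply: homog_deg.
- by apply: P_deg; apply: homog_deg.
Qed.

Lemma prod_term_mul_group : (forall a b g,
    P a (b * cp_group rG g) = P a b * cp_group rG g) ->
  forall k a b g,
    prod_term k a (b * cp_group rG g) = prod_term k a b * cp_group rG g.
Proof.
move=> PG k a b g.
have tl b' := (prod_term_bilinear k).1 b'.
have tr a' := (prod_term_bilinear k).2 a'.
move: a; apply: linear_ext_homog; first exact: tl.
  exact: (linear_comp (mull_linear _) (tl _)).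
move=> d a ad; move: b; apply: linear_ext_homog.
- exact: (linear_comp (tr _) (mull_linear _)).
- exact: (linear_comp (mull_linear _) (tr _)).
move=> e b be.
have bge : cp_homog e (b * cp_group rG g) = b * cp_group rG g.
  by rewrite /cp_homog cp_map_mul_group -/(cp_homog e b) be.
rewrite (prod_term_homog k ad be) (prod_term_homog k ad bge) PG /drop_part.
by case: ifP => _; rewrite ?mul0r // /cp_homog cp_map_mul_group.
Qed.

Lemma prod_term_mid_group : (forall a b g,
    P (a * cp_group rG g) b = P a (cp_group rG g * b)) ->
  forall k a b g,
    prod_term k (a * cp_group rG g) b = prod_term k a (cp_group rG g * b).
Proof.
move=> PG k a b g.
have tl b' := (prod_term_bilinear k).1 b'.
have tr a' := (prod_term_bilinear k).2 a'.
move: a; apply: linear_ext_homog; last 1 first.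
- move=> d a ad; move: b; apply: linear_ext_homog.
  + exact: tr.
  + exact: (linear_comp (tr _) (mulr_linear _)).
  move=> e b be.
  have age : cp_homog d (a * cp_group rG g) = a * cp_group rG g.
    by rewrite /cp_homog cp_map_mul_group -/(cp_homog d a) ad.
  have bge : cp_homog e (cp_group rG g * b) = cp_group rG g * b.
    by rewrite cp_homog_group be.
  by rewrite (prod_term_homog k age be) (prod_term_homog k ad bge) PG.
- exact: (linear_comp (tl _) (mull_linear _)).
- exact: tl.
Qed.

Lemma prod_term_group : (forall a b g,
    cp_group rG g * P a b = P (cp_group rG g * a) b) ->
  forall k a b g,
    prod_term k (cp_group rG g * a) b = cp_group rG g * prod_term k a b.
Proof.
move=> PG k a b g.
have tl b' := (prod_term_bilinear k).1 b'.
have tr a' := (prod_term_bilinear k).2 a'.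
move: a; apply: linear_ext_homog.
- exact: (linear_comp (tl _) (mulr_linear _)).
- exact: (linear_comp (mulr_linear _) (tl _)).
move=> d a ad; move: b; apply: linear_ext_homog; first exact: tr.
  exact: (linear_comp (mulr_linear _) (tr _)).
move=> e b be.
have age : cp_homog d (cp_group rG g * a) = cp_group rG g * a.
  by rewrite cp_homog_group ad.
rewrite (prod_term_homog k ad be) (prod_term_homog k age be) -PG /drop_part.
by case: ifP => _; [rewrite cp_homog_group|rewrite mulr0].
Qed.

End Terms.
End GradedSum.

(** * Planes and commuting projections *)

Section CommutingMatrices.
Variables (R : fieldType) (n : nat).
Implicit Types (L M N : 'M[R]_n).

Lemma mulmx_comm_compl M N : M *m N = N *m M ->
  (1%:M - M) *m N = N *m (1%:M - M).
Proof. by move=> MN; rewrite mulmxBl mulmxBr mul1mx mulmx1 MN. Qed.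

(** By commutation, both row spaces lie in that of [M]; they are in direct sum
    since [N] acts on them by 1 and 0. *)
Lemma mxrank_split M N : N *m N = N -> M *m N = N *m M ->
  (\rank (M *m N) + \rank (M *m (1%:M - N)) <= \rank M)%N.
Proof.
move=> NN MN; have MN' : M *m (1%:M - N) = (1%:M - N) *m M.
  by rewrite mulmx_comm_compl.
have dis : (M *m N :&: M *m (1%:M - N) = 0)%MS.
  apply/eqP; rewrite -submx0; apply/row_subP => i.
  have := row_sub i (M *m N :&: M *m (1%:M - N))%MS.
  rewrite sub_capmx => /andP[/submxP[u uE] /submxP[u' u'E]].
  have : row i (M *m N :&: M *m (1%:M - N))%MS *m N = 0.
    by rewrite u'E -!mulmxA mulmxBl mul1mx NN subrr !mulmx0.
  by rewrite {1}uE -!mulmxA NN -uE => ->; rewrite sub0mx.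
rewrite -(mxrank_disjoint_sum dis); apply: mxrankS.
by rewrite addsmx_sub MN MN' !submxMl.
Qed.

Lemma rank_factor k M : (\rank M <= k)%N ->
  exists (C : 'M[R]_(n, k)) (B : 'M[R]_(k, n)), M = C *m B.
Proof.
move=> rk.
exists (col_base M *m pid_mx (\rank M)), (pid_mx (\rank M) *m row_base M).
rewrite mulmxA -(mulmxA (col_base M)) mul_pid_mx minnn.
by rewrite (minn_idPr _) // pid_mx_1 mulmx1 mulmx_base.
Qed.

Lemma mulmx_comm_comp L M N : L *m N = N *m L -> M *m N = N *m M ->
  L *m M *m N = N *m (L *m M).
Proof. by move=> LN MN; rewrite -mulmxA MN !mulmxA LN. Qed.

Lemma mulmx_idem_comp M N : M *m M = M -> N *m N = N -> M *m N = N *m M ->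
  M *m N *m (M *m N) = M *m N.
Proof.
by move=> MM NN MN; rewrite mulmxA -(mulmxA M N M) -MN mulmxA MM -mulmxA NN.
Qed.

(** If [M] is a column [u] times a row [w], then [M N = M N M] is the number
    [w N u] times [M]. *)
Lemma rank1_commute M N : (\rank M <= 1)%N -> M *m M = M -> M *m N = N *m M ->
  exists l, M *m N = l *: M.
Proof.
move=> /rank_factor[u [w ME]] MM MN; exists ((w *m N *m u) 0 0).
have := mx11_scalar (w *m N *m u); move: (_ 0 0) => l E.
rewrite -{1}MM -mulmxA MN {1 2}ME !mulmxA.
rewrite -[u *m w *m N]mulmxA -[u *m _ *m u]mulmxA.
by rewrite E mul_mx_scalar -scalemxAl -ME.
Qed.

End CommutingMatrices.

Section PlaneForms.
Variables (R : fieldType) (n : nat) (W : lmodType R).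
Implicit Types (x y z : 'rV[R]_n).

(** An alternating trilinear form on a plane vanishes; the cyclic sum of [T]
    on the image of [Q], which has dimension at most 2, is such a form. *)
Lemma alternating_plane (T : 'rV[R]_n -> 'rV[R]_n -> 'rV[R]_n -> W)
    (Q : 'M[R]_n) :
  (forall y z, linear (fun x => T x y z)) ->
  (forall x z, linear (fun y => T x y z)) ->
  (forall x y, linear (T x y)) -> (forall x z, T x x z = 0) ->
  (\rank Q <= 2)%N -> forall x y z,
  T (x *m Q) (y *m Q) (z *m Q) + T (y *m Q) (z *m Q) (x *m Q)
    + T (z *m Q) (x *m Q) (y *m Q) = 0.
Proof.
move=> Tx Ty Tz Talt rQ.
have [U [w0 [w1 QE]]] : exists U : 'rV[R]_n -> 'I_2 -> R, exists w0 w1,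
    forall x, x *m Q = U x 0 *: w0 + U x 1 *: w1.
  have [C [B QE]] := rank_factor rQ.
  exists (fun x i => (x *m C) 0 i), (row 0 B), (row 1 B) => x.
  rewrite QE mulmxA mulmx_sum_row big_ord_recl big_ord1.
  by have -> : lift ord0 ord0 = 1 :> 'I_2 by apply/val_inj.
have Tskew x y z : T x y z = - T y x z.
  have := Talt (x + y) z.
  rewrite (linearD_prop (Tx _ _)) !(linearD_prop (Ty _ _)).
  by rewrite !Talt add0r addr0 => /eqP; rewrite addr_eq0 => /eqP.
have E x y z : T (x *m Q) (y *m Q) (z *m Q)
  = ((U x 0 * U y 1 - U x 1 * U y 0) * U z 0) *: T w0 w1 w0
    + ((U x 0 * U y 1 - U x 1 * U y 0) * U z 1) *: T w0 w1 w1.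
  rewrite !QE (linearD_prop (Tx _ _)) !(linearD_prop (Ty _ _)).
  rewrite !(linearZ_prop (Tx _ _)) !(linearZ_prop (Ty _ _)) !Talt.
  rewrite (Tskew w1 w0) !scaler0 add0r addr0 !scalerN !scalerA -scalerBl.
  rewrite (linearD_prop (Tz _ _)) !(linearZ_prop (Tz _ _)) scalerDr !scalerA.
  by [].
move=> x y z; rewrite !E [X in X + _]addrACA [LHS]addrACA -!scalerDl.
rewrite (_ : _ + _ + _ = 0); last by ring.
rewrite (_ : _ + _ + _ = 0); last by ring.
by rewrite !scale0r addr0.
Qed.

End PlaneForms.

(** * The splitting of V by a group element *)

Section Splitting.
Variables (R : realType) (gT : finGroupType) (n : nat).
Variable rG : mx_representation R [set: gT] n.
Variable ip : {dot 'cV[R]_n for idfun}.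
Hypothesis ip_inv : invariant_form rG ip.
Implicit Types (g h : gT) (u v w : 'cV[R]_n).

Local Notation fixsp := (fixsp rG).
Local Notation normsp := (normsp rG ip).
Local Notation fixproj := (fixproj rG ip).
Local Notation normproj := (normproj rG ip).

Lemma rG_mul g h : rG (g * h)%g = rG g *m rG h.
Proof. by rewrite repr_mxM ?inE. Qed.

Lemma fixspP g v : reflect (rG g *m v = v) (v \in fixsp g).
Proof. by apply: (iffP fixedSpaceP); rewrite lfunE. Qed.

Lemma fixsp_cycle g h v : v \in fixsp g -> h \in <[g]>%g -> rG h *m v = v.
Proof.
move=> /fixspP gv /cycleP [i ->]; elim: i => [|i IHi].
  by rewrite expg0 repr_mx1 mul1mx.
by rewrite expgS rG_mul -mulmxA IHi.
Qed.

(** The orthogonal projection onto the fixed space; as a polynomial in the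
    matrices of the powers of [g], it commutes with everything that commutes
    with [g]. *)
Definition average g : 'M[R]_n :=
  #|<[g]>%g|%:R^-1 *: \sum_(h in <[g]>%g) rG h.

Lemma average_fix g v : average g *m v \in fixsp g.
Proof.
apply/fixspP; rewrite /average mulmxA -scalemxAr; congr (_ *: _ *m _).
rewrite mulmx_sumr [RHS](reindex_inj (mulgI g)) /=; apply: eq_big => h.
  by rewrite groupMl // cycle_id.
by rewrite rG_mul.
Qed.

Lemma average_norm g v : v - average g *m v \in normsp g.
Proof.
apply/mem_orthovP => u ug; rewrite linearBl /=; apply/eqP; rewrite subr_eq0.
rewrite /average -scalemxAl linearZl_LR /= mulmx_suml linear_sumlz /=.
rewrite (eq_bigr (fun=> ip v u)) => [|h hg].
  rewrite sumr_const -(mulr_natl (ip v u)) mulrA mulVf ?mul1r ?pnatr_eq0 //.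
  by rewrite -lt0n cardG_gt0.
by rewrite -{1}(fixsp_cycle ug hg) ip_inv.
Qed.

Lemma fix_norm_eq0 g v : v \in fixsp g -> v \in normsp g -> v = 0.
Proof.
move=> vf /mem_orthovP /(_ v vf) vv; apply/eqP; apply: contraTT isT => v0.
by have := neq0_dnorm_gt0 (s := ip) v v0; rewrite vv ltxx.
Qed.

Lemma capv_fix_norm g : (fixsp g :&: normsp g = 0)%VS.
Proof.
apply/eqP; rewrite -subv0; apply/subvP => v; rewrite memv_cap => /andP[vf vn].
by rewrite (fix_norm_eq0 vf vn) mem0v.
Qed.

Lemma colmxE (f : 'End('cV[R]_n)) v : colmx f *m v = f v.
Proof.
rewrite {2}[v]matrix_sum_delta linear_sum /=; apply/colP => i.
rewrite mxE summxE; apply: eq_bigr => j _.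
by rewrite big_ord1 linearZ /= !mxE mulrC.
Qed.

Lemma addv_fix_norm g v : v \in (fixsp g + normsp g)%VS.
Proof.
rewrite -[v](subrK (average g *m v)) addrC.
by apply: memv_add; [apply: average_fix|apply: average_norm].
Qed.

Lemma fixprojDnormproj g : fixproj g + normproj g = 1%:M.
Proof.
apply/matrixP => i j; apply/esym.
have := daddv_pi_add (capv_fix_norm g) (addv_fix_norm g (delta_mx j 0)).
move=> /colP/(_ i); rewrite -!colmxE -mulmxDl -colE [RHS]mxE eqxx andbT.
by rewrite [LHS]mxE => ->; rewrite mxE.
Qed.

Lemma fixproj_id g v : v \in fixsp g -> fixproj g *m v = v.
Proof. by move=> vf; rewrite colmxE daddv_pi_id // capv_fix_norm. Qed.

Lemma normproj_id g v : v \in normsp g -> normproj g *m v = v.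
Proof. by move=> vf; rewrite colmxE daddv_pi_id // capvC capv_fix_norm. Qed.

Lemma fixproj_fix g v : fixproj g *m v \in fixsp g.
Proof. by rewrite colmxE memv_pi. Qed.

Lemma normproj_norm g v : normproj g *m v \in normsp g.
Proof. by rewrite colmxE memv_pi. Qed.

Lemma normprojE g : normproj g = 1%:M - fixproj g.
Proof. by rewrite -(fixprojDnormproj g) addrC addKr. Qed.

Lemma fixproj_norm g v : v \in normsp g -> fixproj g *m v = 0.
Proof.
move=> /normproj_id E; rewrite -[fixproj g](addrK (normproj g)).
by rewrite fixprojDnormproj mulmxBl mul1mx E subrr.
Qed.

Lemma eq_mulmx (M N : 'M[R]_n) : (forall v, M *m v = N *m v) -> M = N.
Proof.
by move=> MN; apply/matrixP => i j; have /colP/(_ i) := MN (delta_mx j 0);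
  rewrite -!colE !mxE.
Qed.

Lemma fixprojE g : fixproj g = average g.
Proof.
apply: eq_mulmx => v; rewrite -[in LHS](subrK (average g *m v) v) mulmxDr.
by rewrite fixproj_norm ?average_norm // add0r fixproj_id // average_fix.
Qed.

Lemma normproj_idem g : normproj g *m normproj g = normproj g.
Proof.
by apply: eq_mulmx => v; rewrite -mulmxA normproj_id // normproj_norm.
Qed.

Lemma fixproj_normproj g : fixproj g *m normproj g = 0.
Proof.
by apply: eq_mulmx => v; rewrite -mulmxA fixproj_norm ?normproj_norm // mul0mx.
Qed.

Lemma fixproj_rG g h : h \in <[g]>%g -> fixproj g *m rG h = fixproj g.
Proof.
move=> hg; rewrite fixprojE /average -scalemxAl; congr (_ *: _).
rewrite mulmx_suml [RHS](reindex_inj (mulIg h)) /=; apply: eq_big => k.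
  by rewrite groupMr.
by rewrite rG_mul.
Qed.

Lemma rank_normproj g : (\rank (normproj g) <= codim rG ip g)%N.
Proof.
pose b := vbasis (normsp g).
pose B : 'M[R]_(n, codim rG ip g) := \matrix_(k, i) b`_i k 0.
pose C : 'M[R]_(codim rG ip g, n) :=
  \matrix_(i, j) coord b i (normproj g *m delta_mx j 0).
suff -> : normproj g = B *m C.
  exact: leq_trans (mxrankM_maxl _ _) (rank_leq_col _).
apply/matrixP => k j.
have /colP/(_ k) := coord_vbasis (normproj_norm g (delta_mx j 0)).
rewrite -colE [LHS]mxE => ->; rewrite summxE mxE; apply: eq_bigr => i _.
by rewrite !mxE mulrC -colE.
Qed.

Lemma fixproj1 : fixproj 1%g = 1%:M.
Proof.
by apply: eq_mulmx => v; rewrite mul1mx fixproj_id //; apply/fixspP;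
  rewrite repr_mx1 mul1mx.
Qed.

Lemma codim1 : codim rG ip 1%g = 0%N.
Proof.
apply/eqP; rewrite dimv_eq0 -subv0; apply/subvP => v vn.
by rewrite -[v]mul1mx -fixproj1 fixproj_norm // mem0v.
Qed.

Lemma normsp_fix g v : normproj g *m v = 0 -> v \in fixsp g.
Proof.
move=> v0; suff <- : fixproj g *m v = v by apply: fixproj_fix.
by rewrite -[RHS]mul1mx -(fixprojDnormproj g) mulmxDl v0 addr0.
Qed.

Hypothesis abelianG : abelian [set: gT].

Lemma rG_comm g h : rG g *m rG h = rG h *m rG g.
Proof.
by rewrite -!rG_mul; congr (rG _); apply: (centsP abelianG); rewrite inE.
Qed.

Lemma fixproj_rGC g h : fixproj g *m rG h = rG h *m fixproj g.
Proof.
rewrite fixprojE /average -scalemxAl -scalemxAr mulmx_suml mulmx_sumr.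
by congr (_ *: _); apply: eq_bigr => k _; rewrite rG_comm.
Qed.

Lemma normproj_rGC g h : normproj g *m rG h = rG h *m normproj g.
Proof. by rewrite normprojE; apply/mulmx_comm_compl/fixproj_rGC. Qed.

Lemma fixprojC g h : fixproj g *m fixproj h = fixproj h *m fixproj g.
Proof.
rewrite (fixprojE h) /average -scalemxAl -scalemxAr mulmx_suml mulmx_sumr.
by congr (_ *: _); apply: eq_bigr => k _; rewrite fixproj_rGC.
Qed.

Lemma normproj_fixprojC g h : normproj g *m fixproj h = fixproj h *m normproj g.
Proof. by rewrite normprojE; apply/mulmx_comm_compl/fixprojC. Qed.

Lemma normprojC g h : normproj g *m normproj h = normproj h *m normproj g.
Proof.
by rewrite (normprojE h); apply/esym/mulmx_comm_compl/esym/normproj_fixprojC.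
Qed.

End Splitting.

(** * The Poisson conditions for an abelian group *)

#[local] Opaque fixproj normproj.

Section PoissonPBW.
Variables (R : realType) (gT : finGroupType) (n : nat).
Variable rG : mx_representation R [set: gT] n.
Variable ip : {dot 'cV[R]_n for idfun}.
Variable pi : gT -> 'rV[R]_n -> 'rV[R]_n -> 'rV[R]_n.
Hypothesis abelianG : abelian [set: gT].
Hypothesis ip_inv : invariant_form rG ip.
Hypothesis piP : linear_poisson rG ip pi.
Implicit Types (g h : gT) (x y z c : 'rV[R]_n).
Local Notation "g ** x" := (dual_act rG g x) (at level 30).
Local Notation codim := (codim rG ip).
Local Notation P := (fixproj rG ip).
Local Notation Q := (normproj rG ip).

Lemma pi_linearl g y : linear (pi g ^~ y).
Proof. by case: (linear_poisson_alt piP g) => + _ _; apply. Qed.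

Lemma pi_linearr g x : linear (pi g x).
Proof. by case: (linear_poisson_alt piP g) => _ + _; apply. Qed.

Lemma pi_alternating g x : pi g x x = 0.
Proof. by case: (linear_poisson_alt piP g) => _ _; apply. Qed.

Lemma pi_alternating_skew g x y : pi g x y = - pi g y x.
Proof.
have := pi_alternating g (x + y); rewrite (linearD_prop (pi_linearl _ _)).
rewrite !(linearD_prop (pi_linearr _ _)) !pi_alternating add0r addr0 => /eqP.
by rewrite addr_eq0 => /eqP.
Qed.

Lemma splitPQ g x : x = x *m P g + x *m Q g.
Proof. by rewrite -mulmxDr fixprojDnormproj ?mulmx1. Qed.

Lemma dual_actP g h x : g \in <[h]>%g -> g ** (x *m P h) = x *m P h.
Proof.
by move=> gh; rewrite /dual_act -mulmxA fixproj_rG // groupV.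
Qed.

Lemma pi_value g x y : codim g = 2%N -> pi g x y *m Q g = 0.
Proof.
move=> /(linear_poisson_supp piP) [vN _]; apply/rowP => j.
have /rowP/(_ 0) := vN x y _ (normproj_norm rG ip g (delta_mx j 0)).
by rewrite mulmxA -colE !mxE.
Qed.

Lemma pi_value_fix g x y : codim g = 2%N -> pi g x y *m P g = pi g x y.
Proof. by move=> g2; rewrite [RHS](splitPQ g) pi_value // addr0. Qed.

Lemma pi_supportl g x y : codim g = 2%N -> pi g (x *m Q g) y = pi g x y.
Proof.
move=> /(linear_poisson_supp piP) [_ sN].
rewrite [in RHS](splitPQ g x) (linearD_prop (pi_linearl _ _)).
rewrite [X in _ = X + _]sN ?add0r // => v vN.
by rewrite -mulmxA fixproj_norm ?mulmx0.
Qed.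

Lemma pi_supportr g x y : codim g = 2%N -> pi g x (y *m Q g) = pi g x y.
Proof.
by move=> g2; rewrite pi_alternating_skew pi_supportl // -pi_alternating_skew.
Qed.

Lemma pi_fixl g x y : codim g = 2%N -> pi g (x *m P g) y = 0.
Proof.
move=> g2; rewrite -pi_supportl // -mulmxA fixproj_normproj // mulmx0.
exact: linear0_prop (pi_linearl _ _).
Qed.

Lemma pi_invariant g h x y : h ** pi g x y = pi g (h ** x) (h ** y).
Proof.
rewrite -(linear_poisson_inv piP); congr (pi _ _ _).
have -> : (h * g = g * h)%g by apply: (centsP abelianG); rewrite inE.
by rewrite mulgK.
Qed.

Lemma pi_codim g x y : g != 1%g -> codim g <> 2%N -> pi g x y = 0.
Proof. by move=> g1 g2; apply: (linear_poisson_zero piP). Qed.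

Lemma average_dual g c :
  (forall h, h \in <[g]>%g -> h ** c = c) -> c *m P g = c.
Proof.
move=> cg; rewrite fixprojE // /average -scalemxAr mulmx_sumr.
rewrite (eq_bigr (fun=> c)) => [|h hg].
  rewrite sumr_const -scaler_nat scalerA mulVf ?scale1r // pnatr_eq0 -lt0n.
  exact: cardG_gt0.
by have := cg h^-1%g; rewrite groupV /dual_act invgK; apply.
Qed.

Lemma normprojQ g : 1%:M - Q g = P g.
Proof. by rewrite -(fixprojDnormproj ip_inv g) addrK. Qed.

Lemma fixproj_of_normproj0 g (v : 'cV[R]_n) : Q g *m v = 0 -> rG g *m v = v.
Proof. by move=> v0; apply/fixspP; apply: (normsp_fix ip_inv). Qed.

Lemma dual_act_normproj a b c : Q a *m Q b = 0 -> a ** c *m Q b = c *m Q b.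
Proof.
move=> ab; rewrite /dual_act -mulmxA; congr (_ *m _).
have E : rG a *m Q b = Q b.
  apply: eq_mulmx => v.
  by rewrite -mulmxA fixproj_of_normproj0 // mulmxA ab mul0mx.
by rewrite -{1}E mulmxA -rG_mul mulVg repr_mx1 mul1mx.
Qed.

(** An isometry acts on a line by a scalar of square 1, and [b] fixes no vector
    of its normal space. *)
Lemma line_reflection a b : (\rank (Q a *m Q b) <= 1)%N ->
  Q a *m Q b *m rG b^-1%g = - (Q a *m Q b).
Proof.
have ZM : Q a *m Q b *m rG b^-1%g = rG b^-1%g *m (Q a *m Q b).
  by apply: mulmx_comm_comp; apply: normproj_rGC.
have ZZ : Q a *m Q b *m (Q a *m Q b) = Q a *m Q b.
  by apply: mulmx_idem_comp;
    [exact: normproj_idem|exact: normproj_idem|exact: normprojC].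
have ZN v : Q a *m Q b *m v \in normsp rG ip b.
  by rewrite (normprojC ip_inv abelianG a b) -mulmxA normproj_norm.
have Mfix v : rG b^-1%g *m v = v -> v \in fixsp rG b.
  by move=> E; apply/fixspP; rewrite -{1}E mulmxA -rG_mul mulgV repr_mx1 mul1mx.
move: (Q a *m Q b) (rG b^-1%g) (ip_inv b^-1%g) Mfix ZM ZZ ZN.
move=> Z M Minv Mfix ZM ZZ ZN rZ.
have [l ZMl] := rank1_commute rZ ZZ ZM.
have [->|Z0] := eqVneq Z 0; first by rewrite mul0mx oppr0.
have [j Zj] : exists j, Z *m delta_mx j 0 != 0 :> 'cV_n.
  apply/existsP; apply: contraNT Z0; rewrite negb_exists => /forallP Zj.
  apply/eqP; apply: eq_mulmx => v; rewrite mul0mx [v]matrix_sum_delta.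
  rewrite mulmx_sumr big1 // => i _; rewrite big_ord1 -scalemxAr.
  by move: (Zj i); rewrite negbK => /eqP ->; rewrite scaler0.
pose e : 'cV[R]_n := delta_mx j 0; have vN := ZN e.
have [v vE] : exists v, v = Z *m e by exists (Z *m e).
rewrite -/e -vE in vN Zj.
have Mv : M *m v = l *: v.
  by rewrite vE mulmxA -ZM ZMl -scalemxAl.
have l2 : l ^+ 2 = 1.
  have := Minv v v; rewrite Mv linearZl_LR linearZr_LR /= => /eqP.
  rewrite mulrA -expr2 -subr_eq0 -[X in _ - X]mul1r -mulrBl mulf_eq0.
  have /lt0r_neq0/negPf -> := neq0_dnorm_gt0 (s := ip) v Zj.
  by rewrite orbF subr_eq0 => /eqP.
move/eqP: l2; rewrite sqrf_eq1 ZMl => /orP[] /eqP l1.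
  2: by rewrite l1 scaleN1r.
case/eqP: Zj; apply: (fix_norm_eq0 _ vN).
by apply: Mfix; rewrite Mv l1 scale1r.
Qed.

Lemma normproj_split a b c : c *m Q a = c *m (Q a *m Q b) + c *m (Q a *m P b).
Proof.
by rewrite -mulmxDr -mulmxDr [Q b + P b]addrC fixprojDnormproj // mulmx1.
Qed.

(** Elements of codimension 2 do not interact. As the group is abelian, the
    planes [N^a] and [N^b] split along each other. If they are equal or meet
    trivially, the values of [pi b] are invariant under [a]; if they meet in a
    line, [b] acts on that line by [-1], which leaves a single direction in
    [N^a] for both arguments of the alternating form [pi a]. *)
Lemma pi_pi_eq0 a b x y z : codim a = 2%N -> codim b = 2%N ->
  pi a (pi b x y) (z + b ** z) = 0.
Proof.
move=> a2 b2; set c := pi b x y; set d := z + _.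
have ranks : (\rank (Q a *m Q b) + \rank (Q a *m P b) <= 2)%N.
  have rQ : (\rank (Q a) <= 2)%N by rewrite -a2; apply: rank_normproj.
  rewrite -normprojQ; apply: leq_trans rQ; apply: mxrank_split.
    exact: normproj_idem.
  exact: normprojC.
have cQ : c *m (Q a *m Q b) = 0.
  by rewrite (normprojC ip_inv abelianG a b) mulmxA pi_value // mul0mx.
have case_c0 : c *m Q a = 0 -> pi a c d = 0.
  move=> c0; rewrite -pi_supportl // c0.
  exact: linear0_prop (pi_linearl _ _).
have [Z0|Z0] := eqVneq (Q a *m Q b) 0.
  apply: case_c0; suff <- : c *m P a = c.
    by rewrite -mulmxA fixproj_normproj // mulmx0.
  apply: average_dual => h /cycleP[i ->]; elim: i => [|i IHi].
    by rewrite expg0 /dual_act invg1 repr_mx1 mulmx1.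
  have aQ w : pi b (a ** w) =1 pi b w.
    by move=> w'; rewrite -pi_supportl // dual_act_normproj // pi_supportl.
  have aQ' w w' : pi b w (a ** w') = pi b w w'.
    by rewrite pi_alternating_skew aQ -pi_alternating_skew.
  have ac : a ** c = c by rewrite /c pi_invariant aQ aQ'.
  by rewrite expgS /dual_act invMg rG_mul mulmxA -/(dual_act rG _ c) IHi.
have [Z'0|Z'0] := eqVneq (Q a *m P b) 0.
  by apply: case_c0; rewrite (normproj_split a b) cQ Z'0 mulmx0 addr0.
have rZ : (\rank (Q a *m Q b) <= 1)%N.
  move: ranks Z'0; rewrite -mxrank_eq0; move: (\rank _) (\rank _) => r1 r2.
  by lia.
have rZ' : (\rank (Q a *m P b) <= 1)%N.
  move: ranks Z0; rewrite -mxrank_eq0; move: (\rank _) (\rank _) => r1 r2.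
  by lia.
have dQ : d *m (Q a *m Q b) = 0.
  rewrite /d mulmxDl /dual_act -mulmxA.
  have -> : rG b^-1%g *m (Q a *m Q b) = Q a *m Q b *m rG b^-1%g.
    by apply/esym/mulmx_comm_comp; apply: normproj_rGC.
  by rewrite line_reflection // mulmxN subrr.
rewrite -pi_supportl // -pi_supportr //.
rewrite (normproj_split a b) cQ add0r (normproj_split a b d) dQ add0r.
have [u [w ->]] := rank_factor rZ'.
rewrite !mulmxA [c *m u]mx11_scalar [d *m u]mx11_scalar !mul_scalar_mx.
rewrite (linearZ_prop (pi_linearl _ _)) (linearZ_prop (pi_linearr _ _)).
by rewrite pi_alternating !scaler0.
Qed.

Lemma codim_neq1 g : codim g = 2%N -> g != 1%g.
Proof. by move=> g2; apply/eqP => g1; rewrite g1 codim1 in g2. Qed.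

Section Shift.
Variables (W : lmodType R) (B : 'rV[R]_n -> 'rV[R]_n -> W).
Hypothesis B_linl : forall y, linear (B ^~ y).
Hypothesis B_linr : forall x, linear (B x).

(** Both [pi g] and [g - 1] factor through the projection onto the dual of the
    plane normal to [g]. *)
Lemma pi_shift_eq0 g x y z :
  B (pi g y z) (g ** x - x) + B (pi g z x) (g ** y - y)
    + B (pi g x y) (g ** z - z) = 0.
Proof.
have [->|g1] := eqVneq g 1%g.
  have E w : 1%g ** w - w = 0.
    by rewrite /dual_act invg1 repr_mx1 mulmx1 subrr.
  by rewrite !E !(linear0_prop (B_linr _)) !addr0.
case: (eqVneq (codim g) 2%N) => [g2|/eqP g2]; last first.
  by rewrite !(pi_codim _ _ g1 g2) !(linear0_prop (B_linl _)) !addr0.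
pose T x y z := B (pi g x y) (g ** z - z).
have TE x' y' z' : B (pi g x' y') (g ** z' - z')
   = T (x' *m Q g) (y' *m Q g) (z' *m Q g).
  rewrite /T pi_supportl // pi_supportr //; congr (B _ _).
  rewrite {1 2}(splitPQ g z') (linearD_prop (dual_act_linear rG g)).
  by rewrite dual_actP ?cycle_id // opprD addrACA subrr add0r.
rewrite !TE; apply: etrans (@alternating_plane _ _ _ T _ _ _ _ _ _ y z x) => //.
- by move=> y' z'; apply: (linear_comp (B_linl _) (pi_linearl _ _)).
- by move=> x' z'; apply: (linear_comp (B_linl _) (pi_linearr _ _)).
- move=> x' y'; apply: (linear_comp (B_linr _)).
  by apply: linear_sub => //; apply: dual_act_linear.
- by move=> x' z'; rewrite /T pi_alternating (linear0_prop (B_linl _)).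
- by rewrite -g2; apply: rank_normproj.
Qed.

End Shift.

Lemma linform_eq0 x : linform x = 0 -> x = 0.
Proof.
move=> x0; apply/rowP => i; have := congr1 (mderiv i) x0.
by rewrite mderiv_linform mderiv0 mxE => /eqP; rewrite mpolyC_eq0 => /eqP.
Qed.

Lemma dual_act1 x : 1%g ** x = x.
Proof. by rewrite /dual_act invg1 repr_mx1 mulmx1. Qed.

Lemma linear_addact g : linear (fun z => z + g ** z).
Proof. by apply: linear_add => //; apply: dual_act_linear. Qed.

Lemma bracket1_eq0 (x : 'I_3 -> 'rV[R]_n) : bracket rG pi 1%g x = 0.
Proof.
have := linear_poisson_bracket piP 1%g x.
rewrite /pr codim1 // (big_pred1 set0) => [|J]; last by rewrite /= cards_eq0.
rewrite fixproj1 // sym_map1 => /linform_eq0 <-; apply: eq_bigr => ab _.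
by rewrite !inE !mulmx1.
Qed.

(** The remaining terms of the bracket vanish by [pi_pi_eq0]. *)
Lemma bracket_two_terms g (x : 'I_3 -> 'rV[R]_n) : g != 1%g ->
  let A u v w := pi 1%g (pi g u v) (w + g ** w) in
  let C u v w := pi g (pi 1%g u v) (w + w) in
  bracket rG pi g x =
    A (x 0) (x 1) (x 2) + A (x 1) (x 2) (x 0) + A (x 2) (x 0) (x 1)
    + (C (x 0) (x 1) (x 2) + C (x 1) (x 2) (x 0) + C (x 2) (x 0) (x 1)).
Proof.
move=> g1 A C; rewrite /bracket (bigD1 (1%g, g)) /= ?mul1g //.
rewrite (bigD1 (g, 1%g)) /= ?mulg1 ?eqxx ?andbT; last first.
  by rewrite xpair_eqE negb_and g1.
rewrite [X in _ + (_ + X)]big1 => [|[a b] /= /andP[/andP[/eqP abg ab1] ab2]].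
  by rewrite addr0 !dual_act1.
have a1 : a != 1%g.
  by apply: contraNneq ab1 => a1; rewrite -abg a1 mul1g.
have b1 : b != 1%g.
  by apply: contraNneq ab2 => b1; rewrite -abg b1 mulg1.
case: (eqVneq (codim a) 2%N) => [a2|/eqP a2]; last first.
  by rewrite !(pi_codim _ _ a1 a2) !addr0.
case: (eqVneq (codim b) 2%N) => [b2|/eqP b2]; last first.
  by rewrite !(pi_codim _ _ b1 b2) !(linear0_prop (pi_linearl _ _)) !addr0.
by rewrite !pi_pi_eq0 // !addr0.
Qed.

Lemma sum_card2 (W : zmodType) (F : {set 'I_3} -> W) :
  \sum_(J : {set 'I_3} | #|J| == 2%N) F J
    = F (~: [set 0]) + F (~: [set 1]) + F (~: [set 2]).
Proof.
have -> : \sum_(J : {set 'I_3} | #|J| == 2%N) F J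
    = \sum_(J in [set ~: [set i] | i : 'I_3]) F J.
  apply: eq_bigl => J; apply/idP/imsetP => [/eqP J2|[i _ ->]]; last first.
    by rewrite cardsC1 card_ord.
  have /eqP/cards1P[i Ji] : #|~: J| = 1%N by rewrite cardsCs setCK card_ord J2.
  by exists i; rewrite // -Ji setCK.
rewrite big_imset => [|i j _ _ /setC_inj/set1_inj //] /=.
rewrite !big_ord_recl big_ord0 addr0 addrA.
by congr (_ + F (~: [set _]) + F (~: [set _])); apply/val_inj.
Qed.

Section PlaneBracket.
Variable g : gT.
Hypothesis g2 : codim g = 2%N.
Let A u v w := pi 1%g (pi g u v) (w + g ** w).
Let C u v w := pi g (pi 1%g u v) (w + w).

Let A_linl v w : linear (fun u => A u v w).
Proof. exact: (linear_comp (pi_linearl _ _) (pi_linearl _ _)). Qed.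
Let A_linm u w : linear (fun v => A u v w).
Proof. exact: (linear_comp (pi_linearl _ _) (pi_linearr _ _)). Qed.
Let A_linr u v : linear (A u v).
Proof. exact: (linear_comp (pi_linearr _ _) (linear_addact g)). Qed.
Let C_linl v w : linear (fun u => C u v w).
Proof. exact: (linear_comp (pi_linearl _ _) (pi_linearl _ _)). Qed.
Let C_linm u w : linear (fun v => C u v w).
Proof. exact: (linear_comp (pi_linearl _ _) (pi_linearr _ _)). Qed.
Let C_linr u v : linear (C u v).
Proof. by apply: (linear_comp (pi_linearr _ _)); apply: linear_add. Qed.

Let A_Q u v w : A (u *m Q g) (v *m Q g) w = A u v w.
Proof. by rewrite /A pi_supportl // pi_supportr. Qed.

Let C_Q u v w : C u v (w *m Q g) = C u v w.
Proof. by rewrite /C -mulmxDl pi_supportr. Qed.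

Let A_Pl u v w : A (u *m P g) v w = 0.
Proof. by rewrite /A pi_fixl // (linear0_prop (pi_linearl _ _)). Qed.

Let A_Pm u v w : A u (v *m P g) w = 0.
Proof.
rewrite /A [pi g u _]pi_alternating_skew pi_fixl // oppr0.
exact: linear0_prop (pi_linearl _ _).
Qed.

Let C_P u v w : C u v (w *m P g) = 0.
Proof.
rewrite -C_Q -mulmxA fixproj_normproj // mulmx0.
exact: linear0_prop (C_linr _ _).
Qed.

Lemma pi1_fix u v : pi 1%g (u *m P g) (v *m P g) *m P g
  = pi 1%g (u *m P g) (v *m P g).
Proof.
by apply: average_dual => h hg; rewrite pi_invariant !dual_actP.
Qed.

Let C_PP u v w : C (u *m P g) (v *m P g) w = 0.
Proof. by rewrite /C -pi1_fix pi_fixl. Qed.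

Let A_value u v w : A u v (w *m P g) *m P g = A u v (w *m P g).
Proof.
rewrite /A -(pi_value_fix _ _ g2) dual_actP ?cycle_id // -mulmxDl.
exact: pi1_fix.
Qed.

Let C_value u v w : C u v w *m P g = C u v w.
Proof. exact: pi_value_fix. Qed.

Let rankQ : (\rank (Q g) <= 2)%N.
Proof. by rewrite -g2; apply: rank_normproj. Qed.

Let A_plane u v w : A u v (w *m Q g) + A v w (u *m Q g) + A w u (v *m Q g) = 0.
Proof.
rewrite -(A_Q u v) -(A_Q v w) -(A_Q w u); apply: alternating_plane => //.
by move=> x z; rewrite /A pi_alternating (linear0_prop (pi_linearl _ _)).
Qed.

Let C_plane u v w : C (u *m Q g) (v *m Q g) w + C (v *m Q g) (w *m Q g) u
  + C (w *m Q g) (u *m Q g) v = 0.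
Proof.
rewrite -(C_Q _ _ u) -(C_Q _ _ v) -(C_Q _ _ w); apply: alternating_plane => //.
by move=> x z; rewrite /C pi_alternating (linear0_prop (pi_linearl _ _)).
Qed.

Let A_split u v w : A u v w = A u v (w *m P g) + A u v (w *m Q g).
Proof. by rewrite {1}(splitPQ g w) (linearD_prop (A_linr _ _)). Qed.

Let A_cyc u v w : A u v w + A v w u + A w u v
  = A u v (w *m P g) + A v w (u *m P g) + A w u (v *m P g).
Proof.
rewrite (A_split u v w) (A_split v w u) (A_split w u v).
by rewrite [X in X + _]addrACA [LHS]addrACA (A_plane u v w) addr0.
Qed.

Let C_split u v w : C u v w = C (u *m Q g) (v *m P g) w
  + C (u *m P g) (v *m Q g) w + C (u *m Q g) (v *m Q g) w.
Proof.
rewrite {1}(splitPQ g u) (linearD_prop (C_linl _ _)) {1 2}(splitPQ g v).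
by rewrite !(linearD_prop (C_linm _ _)) C_PP add0r addrCA addrA.
Qed.

Let C_cyc u v w : C u v w + C v w u + C w u v
  = (C (u *m Q g) (v *m P g) w + C (u *m P g) (v *m Q g) w)
    + (C (v *m Q g) (w *m P g) u + C (v *m P g) (w *m Q g) u)
    + (C (w *m Q g) (u *m P g) v + C (w *m P g) (u *m Q g) v).
Proof.
rewrite (C_split u v w) (C_split v w u) (C_split w u v).
by rewrite [X in X + _]addrACA [LHS]addrACA (C_plane u v w) addr0.
Qed.

(** The bracket has only components with two arguments normal to [g] and one
    fixed by [g]: those with three normal arguments vanish since the normal
    space is a plane, and those with at least two fixed arguments since [pi 1]
    of fixed arguments is fixed, hence killed by [pi g]. Its values are fixed
    by [g] too. So the bracket coincides with its projection [pr g]. *)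
Lemma bracket_plane_eq0 (x : 'I_3 -> 'rV[R]_n) : bracket rG pi g x = 0.
Proof.
have g1 := codim_neq1 g2.
pose S u v w := A u v w + A v w u + A w u v + (C u v w + C v w u + C w u v).
have bS (y : 'I_3 -> 'rV[R]_n) : bracket rG pi g y = S (y 0) (y 1) (y 2).
  exact: bracket_two_terms.
have SP u v w : S u v w *m P g = S u v w.
  by rewrite /S A_cyc !mulmxDl !A_value !C_value.
rewrite bS -SP; set u := x 0; set v := x 1; set w := x 2.
have -> : S u v w = S (u *m P g) (v *m Q g) (w *m Q g)
    + S (u *m Q g) (v *m P g) (w *m Q g) + S (u *m Q g) (v *m Q g) (w *m P g).
  rewrite /S !A_Pl !A_Pm !C_P !C_Q !A_Q !add0r !addr0 A_cyc C_cyc.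
  move: (A u v (w *m P g)) (A v w (u *m P g)) (A w u (v *m P g)).
  move: (C (u *m Q g) (v *m P g) w) (C (u *m P g) (v *m Q g) w).
  move: (C (v *m Q g) (w *m P g) u) (C (v *m P g) (w *m Q g) u).
  move: (C (w *m Q g) (u *m P g) v) (C (w *m P g) (u *m Q g) v).
  move=> c1 c2 c3 c4 c5 c6 a1 a2 a3.
  by apply/rowP => j; rewrite !mxE; ring.
apply: linform_eq0; have := linear_poisson_bracket piP g x.
rewrite /pr g2 sum_card2 -!linearD /= sym_map_linform !bS.
by rewrite !inE.
Qed.

End PlaneBracket.

Lemma bracket_eq0 g (x : 'I_3 -> 'rV[R]_n) : bracket rG pi g x = 0.
Proof.
have [->|g1] := eqVneq g 1%g; first exact: bracket1_eq0.
case: (eqVneq (codim g) 2%N) => [g2|/eqP g2]; first exact: bracket_plane_eq0.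
rewrite bracket_two_terms // !(pi_codim _ _ g1 g2).
by rewrite !(linear0_prop (pi_linearl _ _)) !addr0.
Qed.

(** By [pi_shift_eq0] the argument [z + b z] in the bracket may be replaced by
    [2 z]. *)
Lemma pi_jacobi_eq0 g x y z :
  \sum_(ab : gT * gT | (ab.1 * ab.2)%g == g)
    (pi ab.1 (pi ab.2 y z) x + pi ab.1 (pi ab.2 z x) y
       + pi ab.1 (pi ab.2 x y) z) = 0.
Proof.
set S := \sum_(ab | _) _; suff : S + S = 0.
  by move/eqP; rewrite -mulr2n -scaler_nat scaler_eq0 pnatr_eq0 => /eqP.
pose t : 'I_3 -> 'rV[R]_n := fun i => nth 0 [:: y; z; x] i.
rewrite -(bracket_eq0 g t) /bracket -big_split; apply: eq_bigr => [[a b] _] /=.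
rewrite -[LHS]addr0 -(pi_shift_eq0 (pi_linearl a) (pi_linearr a) b x y z).
rewrite /t /= !(linearB_prop (pi_linearr _ _)) !(linearD_prop (pi_linearr _ _)).
move: (pi a (pi b y z) x) (pi a (pi b z x) y) (pi a (pi b x y) z) => p1 p2 p3.
move: (pi a (pi b y z) (b ** x)) (pi a (pi b z x) (b ** y)) => q1 q2.
move: (pi a (pi b x y) (b ** z)) => q3.
by apply/rowP => j; rewrite !mxE; ring.
Qed.

End PoissonPBW.

(** * The quantization *)

Section Quantization.
Variables (R : realType) (gT : finGroupType) (n : nat).
Variable rG : mx_representation R [set: gT] n.
Variable ip : {dot 'cV[R]_n for idfun}.
Variable pi : gT -> 'rV[R]_n -> 'rV[R]_n -> 'rV[R]_n.
Hypothesis abelianG : abelian [set: gT].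
Hypothesis ip_inv : invariant_form rG ip.
Hypothesis piP : linear_poisson rG ip pi.
Local Notation A := (crossed_product rG).
Implicit Types (a b c : A) (v w : 'rV[R]_n) (g : gT).

Let pi_l := pi_linearl piP.
Let pi_r := pi_linearr piP.
Let pi_a := pi_alternating piP.
Let pi_i := linear_poisson_inv piP.
Let pi_s (B : 'rV[R]_n -> 'rV[R]_n -> A) (Bl : forall w, linear (B^~ w))
  (Br : forall v, linear (B v)) := pi_shift_eq0 ip_inv piP Bl Br.
Let pi_j := pi_jacobi_eq0 abelianG ip_inv piP.

Definition quantum_term : nat -> A -> A -> A :=
  prod_term (filtered_prod (rG := rG) pi).

Lemma quantum_term_bilinear k : bilinear_op (quantum_term k).
Proof.
apply: prod_term_bilinear; first exact: filtered_prod_linl.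
exact: filtered_prod_linr.
Qed.

Lemma quantum_term0 a b : quantum_term 0 a b = a * b.
Proof.
apply: prod_term0; [exact: filtered_prod_linl|exact: filtered_prod_linr|].
move=> i j a' b'; exact: filtered_prod_leading.
Qed.

Lemma quantum_term_assoc r a b c :
  \sum_(q < r.+1) quantum_term (r - q) (quantum_term q a b) c
    = \sum_(q < r.+1) quantum_term (r - q) a (quantum_term q b c).
Proof.
apply: prod_term_assoc.
- exact: filtered_prod_linl.
- exact: filtered_prod_linr.
- by move=> i j a' b'; apply: filtered_prod_deg.
- exact: filtered_prodA.
Qed.

Lemma quantum_term_group_bilinear k : group_bilinear (quantum_term k).
Proof.
have Pl := filtered_prod_linl (rG := rG) pi_l pi_r pi_a pi_i.
have Pr := filtered_prod_linr (rG := rG) pi_l pi_r pi_a pi_i.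
move=> g a b; split.
- by apply: prod_term_group => // *; apply: filtered_prod_group.
- by apply: prod_term_mid_group => // *; apply: filtered_prod_mid_group.
- by apply: prod_term_mul_group => // *; apply: filtered_prod_mul_group.
Qed.

Lemma cp_lin_homog v : cp_homog 1 (cp_lin rG v) = cp_lin rG v.
Proof.
apply/ffunP => g; rewrite !ffunE; apply: pihomog_dE.
by case: eqP => _; [apply: linform_homog|apply: rpred0].
Qed.

Lemma quantum_term_skew g (x : 'I_2 -> 'rV[R]_n) :
  skew_part (quantum_term 1) g x = linform (pi g (x 0) (x 1)).
Proof.
have termE v w : quantum_term 1 (cp_lin rG v) (cp_lin rG w)
    = cp_homog 1 (filtered_prod pi (cp_lin rG v) (cp_lin rG w)).
  rewrite /quantum_term.
  rewrite (prod_term_homog _ _ _ (cp_lin_homog v) (cp_lin_homog w)) //.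
    exact: filtered_prod_linl.
  exact: filtered_prod_linr.
rewrite /skew_part !termE -(linearB_prop (@cp_homog_linear _ _ _ rG 1)).
rewrite filtered_prod_lin_comm //.
rewrite (linear_sum_prop (@cp_homog_linear _ _ _ rG 1)).
rewrite sum_ffunE (bigD1 g) //= big1 => [|h /negPf hg].
  rewrite /cp_homog cp_map_mul_group -/(cp_homog 1 _) cp_lin_homog.
  by rewrite mul_groupE mulgV ffunE eqxx addr0.
rewrite /cp_homog cp_map_mul_group -/(cp_homog 1 _) cp_lin_homog.
rewrite mul_groupE ffunE.
by rewrite -eq_mulgV1 eq_sym hg.
Qed.

Lemma pr_poisson g (x : 'I_2 -> 'rV[R]_n) :
  pr rG ip g (fun y => linform (pi g (y 0) (y 1))) x
    = linform (pi g (x 0) (x 1)).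
Proof.
rewrite /pr; have [->|g1] := eqVneq g 1%g.
  rewrite codim1 // (big_pred1 set0) => [|J]; last by rewrite /= cards_eq0.
  by rewrite fixproj1 // sym_map1 !inE !mulmx1.
case: (eqVneq (codim rG ip g) 2%N) => [g2|/eqP g2]; last first.
  rewrite big1 => [|J _]; rewrite (pi_codim piP _ _ g1 g2) linear0 //.
  by rewrite /sym_map rmorph0.
rewrite g2 (big_pred1 [set: 'I_2]) => [|J]; last first.
  have J2 : (#|J| <= 2)%N by rewrite -[X in (_ <= X)%N](card_ord 2) max_card.
  by rewrite /= eqEcard subsetT cardsT card_ord eqn_leq J2.
rewrite !inE sym_map_linform (pi_supportl ip_inv piP) //.
by rewrite (pi_supportr ip_inv piP) // (pi_value_fix ip_inv piP).
Qed.

(** The first coefficient is already bilinear over the group algebra, so it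
    represents its own class. *)
Lemma quantum_term_class : has_class ip pi (star_coef (star_of quantum_term) 1).
Proof.
exists (quantum_term 1); split.
- apply: star_coef1_cocycle quantum_term_assoc.
    exact: quantum_term_bilinear.
  exact: quantum_term0.
- exact: quantum_term_group_bilinear.
- exists (fun _ => 0) => [|a b]; first by move=> c x y; rewrite scaler0 addr0.
  rewrite star_of_coef; last exact: quantum_term_bilinear.
  by rewrite subrr /coboundary2 mulr0 mul0r subr0 addr0.
- move=> g x; rewrite -[RHS]pr_poisson /pr; congr (sym_map _ _).
  by apply: eq_bigr => J _; apply: quantum_term_skew.
Qed.

End Quantization.

Theorem theorem3p4 (R : realType) (gT : finGroupType) (n : nat)
    (rG : mx_representation R [set: gT] n) (ip : {dot 'cV[R]_n for idfun})
    (pi : gT -> 'rV[R]_n -> 'rV[R]_n -> 'rV[R]_n) :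
  abelian [set: gT] -> mx_faithful rG -> invariant_form rG ip ->
  linear_poisson rG ip pi -> quantizable rG ip pi.
Proof.
move=> abelianG _ ip_inv piP.
exists (star_of (quantum_term (rG := rG) pi)); split.
  apply: star_of_star_product.
  - exact: quantum_term_bilinear piP.
  - exact: quantum_term0 piP.
  - exact: quantum_term_assoc abelianG ip_inv piP.
exact: quantum_term_class.
Qed.
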